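(* $\mathsf{RCA}_0$ refutes $\mathsf{FIPP}_1$, i.e., $\mathsf{RCA}_0$ proves $\neg\mathsf{FIPP}_1$.
   Context: Work in second-order arithmetic ($\mathsf{RCA}_0$ as in Simpson, Subsystems of Second Order Arithmetic). For $i\in\mathbb N$, $[i]=\{j: j\le i\}$, with $[-1]=\emptyset$. $\mathrm{Seq}$ is the set of codes of finite sequences; for $l\in\mathrm{Seq}$, $A_l=\{l(i): i<\mathrm{lh}\, l\}$. $|A|=m$ means there is a bijection $[m-1]\to A$; $|A|>m$ means $|A|=m'$ for some $m'>m$. $F:\mathbb N\to\mathbb N$ is extensional if $A_l=A_{l'}$ implies $F(l)=F(l')$ for $l,l'\in\mathrm{Seq}$. A sequence $(l_m)$ is a nested sequence with union if each $l_m\in\mathrm{Seq}$, $A_{l_m}\subseteq A_{l_{m+1}}$ for all $m$, and the set $\bigcup_m A_{l_m}$ exists. $F\in AS$ (asymptotically stable) means $F$ is extensional and for every nested sequence with union $(l_m)$ there is $i$ with $F(l_i)=F(l_j)$ for all $j\ge i$. $\mathsf{FIPP}_1$ is the statement: $\forall n\, \forall F\in AS\, \exists k\, \forall f:[k]\to[n]\, \exists l\in\mathrm{Seq}\, \exists c\in[n]\, [A_l=f^{-1}(c)\wedge |A_l|>F(l)]$. *)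

(* Defs.v *)
From Stdlib Require Import List.

(** De Bruijn indices, with separate index spaces for number variables and for
    set variables: [All1] binds number index 0 and [All2] binds set index 0.
    Number variables are the only variables occurring in terms. *)

Inductive tm : Type :=
| Var (n : nat)
| Zero
| One
| Add (s t : tm)
| Mul (s t : tm).

Inductive fm : Type :=
| Eq (s t : tm)
| Lt (s t : tm)
| Mem (t : tm) (X : nat)
| Bot
| Imp (p q : fm)
| All1 (p : fm)
| All2 (p : fm).

Definition Neg p := Imp p Bot.
Definition And p q := Neg (Imp p (Neg q)).
Definition Or p q := Imp (Neg p) q.
Definition Iff p q := And (Imp p q) (Imp q p).
Definition Ex1 p := Neg (All1 (Neg p)).
Definition Ex2 p := Neg (All2 (Neg p)).

Fixpoint tsubst (f : nat -> tm) (t : tm) : tm :=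
  match t with
  | Var n => f n
  | Zero => Zero
  | One => One
  | Add s u => Add (tsubst f s) (tsubst f u)
  | Mul s u => Mul (tsubst f s) (tsubst f u)
  end.

Definition tshift : tm -> tm := tsubst (fun n => Var (S n)).

Definition scons {A : Type} (a : A) (f : nat -> A) (n : nat) : A :=
  match n with 0 => a | S m => f m end.

(** Simultaneous capture-avoiding substitution of terms for number variables
    and of set variables for set variables. *)
Fixpoint subst (f : nat -> tm) (g : nat -> nat) (p : fm) : fm :=
  match p with
  | Eq s t => Eq (tsubst f s) (tsubst f t)
  | Lt s t => Lt (tsubst f s) (tsubst f t)
  | Mem t X => Mem (tsubst f t) (g X)
  | Bot => Bot
  | Imp q r => Imp (subst f g q) (subst f g r)
  | All1 q => All1 (subst (scons (Var 0) (fun n => tshift (f n))) g q)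
  | All2 q => All2 (subst f (scons 0 (fun n => S (g n))) q)
  end.

Definition shift1 : fm -> fm := subst (fun n => Var (S n)) (fun X => X).
Definition shift2 : fm -> fm := subst Var S.
Definition inst1 (t : tm) : fm -> fm := subst (scons t Var) (fun X => X).
Definition inst2 (X : nat) : fm -> fm := subst Var (scons X (fun Y => Y)).

(** [T] is the set of axioms and [G] the list of open assumptions.  The
    eigenvariable conditions of [prv_all1I] and [prv_all2I] concern [G] only,
    so a member of [T] with free variables stands for its universal closure. *)

Inductive prv (T : fm -> Prop) : list fm -> fm -> Prop :=
| prv_ax G p : T p -> prv T G p
| prv_hyp G p : In p G -> prv T G p
| prv_impI G p q : prv T (p :: G) q -> prv T G (Imp p q)
| prv_impE G p q : prv T G (Imp p q) -> prv T G p -> prv T G q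
| prv_raa G p : prv T (Neg p :: G) Bot -> prv T G p
| prv_all1I G p : prv T (map shift1 G) p -> prv T G (All1 p)
| prv_all1E G p t : prv T G (All1 p) -> prv T G (inst1 t p)
| prv_all2I G p : prv T (map shift2 G) p -> prv T G (All2 p)
| prv_all2E G p X : prv T G (All2 p) -> prv T G (inst2 X p)
| prv_eq_refl G t : prv T G (Eq t t)
| prv_eq_subst G p s t :
    prv T G (Eq s t) -> prv T G (inst1 s p) -> prv T G (inst1 t p).

Definition proves (T : fm -> Prop) (p : fm) : Prop := prv T nil p.

(** To write concrete sentences without index arithmetic, an open term, set or
    formula is represented as a function of the number [d] of enclosing number
    binders and the number [e] of enclosing set binders.  A bound variable
    remembers the depth at which it was bound and computes its de Bruijn index
    at each place where it is used.  [sentence] evaluates at depth 0. *)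

Definition otm : Type := nat -> tm.
Definition oset : Type := nat -> nat.
Definition ofm : Type := nat -> nat -> fm.

Definition oall1 (B : otm -> ofm) : ofm :=
  fun d e => All1 (B (fun d' => Var (d' - S d)) (S d) e).
Definition oex1 (B : otm -> ofm) : ofm :=
  fun d e => Ex1 (B (fun d' => Var (d' - S d)) (S d) e).
Definition oall2 (B : oset -> ofm) : ofm :=
  fun d e => All2 (B (fun e' => e' - S e) d (S e)).
Definition oex2 (B : oset -> ofm) : ofm :=
  fun d e => Ex2 (B (fun e' => e' - S e) d (S e)).

Definition ozero : otm := fun _ => Zero.
Definition oone : otm := fun _ => One.
Definition oadd (s t : otm) : otm := fun d => Add (s d) (t d).
Definition omul (s t : otm) : otm := fun d => Mul (s d) (t d).

Definition oeq (s t : otm) : ofm := fun d _ => Eq (s d) (t d).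
Definition olt (s t : otm) : ofm := fun d _ => Lt (s d) (t d).
Definition omem (t : otm) (X : oset) : ofm := fun d e => Mem (t d) (X e).
Definition otop : ofm := fun _ _ => Neg Bot.
Definition oneg (p : ofm) : ofm := fun d e => Neg (p d e).
Definition oimp (p q : ofm) : ofm := fun d e => Imp (p d e) (q d e).
Definition oand (p q : ofm) : ofm := fun d e => And (p d e) (q d e).
Definition oor (p q : ofm) : ofm := fun d e => Or (p d e) (q d e).
Definition oiff (p q : ofm) : ofm := fun d e => Iff (p d e) (q d e).

Definition sentence (p : ofm) : fm := p 0 0.

Declare Scope otm_scope.
Declare Scope ofm_scope.
Delimit Scope otm_scope with otm.
Delimit Scope ofm_scope with ofm.
Bind Scope otm_scope with otm.
Bind Scope ofm_scope with ofm.

Notation "0" := ozero : otm_scope.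
Notation "1" := oone : otm_scope.
Notation "s + t" := (oadd s t) : otm_scope.
Notation "s * t" := (omul s t) : otm_scope.
Notation "s = t" := (oeq s t) : ofm_scope.
Notation "s < t" := (olt s t) : ofm_scope.
Notation "t \in X" := (omem t X) (at level 70, no associativity) : ofm_scope.
Notation "~ p" := (oneg p) : ofm_scope.
Notation "p -> q" := (oimp p q) : ofm_scope.
Notation "p /\ q" := (oand p q) : ofm_scope.
Notation "p \/ q" := (oor p q) : ofm_scope.
Notation "p <-> q" := (oiff p q) : ofm_scope.
Notation "'ALL' x .. y , p" := (oall1 (fun x => .. (oall1 (fun y => p%ofm)) ..))
  (at level 200, x binder, y binder, right associativity) : ofm_scope.
Notation "'EX' x .. y , p" := (oex1 (fun x => .. (oex1 (fun y => p%ofm)) ..))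
  (at level 200, x binder, y binder, right associativity) : ofm_scope.
Notation "'ALLSET' X , p" := (oall2 (fun X => p%ofm))
  (at level 200, X binder, right associativity) : ofm_scope.
Notation "'EXSET' X , p" := (oex2 (fun X => p%ofm))
  (at level 200, X binder, right associativity) : ofm_scope.

(** Set variables may occur free, but there are no set quantifiers.  Both forms
    of bounded quantifier are listed because [Ex1] and [And] are abbreviations.
    The bound [tshift t] cannot mention the quantified variable. *)
Inductive Sigma00 : fm -> Prop :=
| Sigma00_eq s t : Sigma00 (Eq s t)
| Sigma00_lt s t : Sigma00 (Lt s t)
| Sigma00_mem t X : Sigma00 (Mem t X)
| Sigma00_bot : Sigma00 Bot
| Sigma00_imp p q : Sigma00 p -> Sigma00 q -> Sigma00 (Imp p q)
| Sigma00_all t p :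
    Sigma00 p -> Sigma00 (All1 (Imp (Lt (Var 0) (tshift t)) p))
| Sigma00_ex t p :
    Sigma00 p -> Sigma00 (Ex1 (And (Lt (Var 0) (tshift t)) p)).

Inductive Sigma01 : fm -> Prop :=
| Sigma01_ex p : Sigma00 p -> Sigma01 (Ex1 p).

Inductive Pi01 : fm -> Prop :=
| Pi01_all p : Sigma00 p -> Pi01 (All1 p).

Definition basic_axioms : list fm :=
  map sentence
   ((ALL n, ~ (n + 1 = 0)) ::
    (ALL m n, m + 1 = n + 1 -> m = n) ::
    (ALL m, m + 0 = m) ::
    (ALL m n, m + (n + 1) = (m + n) + 1) ::
    (ALL m, m * 0 = 0) ::
    (ALL m n, m * (n + 1) = (m * n) + m) ::
    (ALL m, ~ (m < 0)) ::
    (ALL m n, m < n + 1 <-> (m < n \/ m = n)) :: nil)%ofm.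

(** In both schemes the distinguished number variable of [p] and [q] has index
    0 and all other free variables are parameters. *)

Definition induction (p : fm) : fm :=
  Imp (And (inst1 Zero p)
           (All1 (Imp p (subst (scons (Add (Var 0) One) (fun n => Var (S n)))
                               (fun X => X) p))))
      (All1 p).

(** [shift2] expresses that the new set variable is not free in [p]. *)
Definition comprehension (p q : fm) : fm :=
  Imp (All1 (Iff p q)) (Ex2 (All1 (Iff (Mem (Var 0) 0) (shift2 p)))).

Inductive RCA0 : fm -> Prop :=
| RCA0_basic p : In p basic_axioms -> RCA0 p
| RCA0_induction p : Sigma01 p -> RCA0 (induction p)
| RCA0_comprehension p q :
    Sigma01 p -> Pi01 q -> RCA0 (comprehension p q).

Definition ole (s t : otm) : ofm := (s < t \/ s = t)%ofm.
Notation "s <= t" := (ole s t) : ofm_scope.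

Definition opair (i j : otm) : otm := ((i + j) * (i + j) + i)%otm.

Definition divides (s t : otm) : ofm := (EX q, t = s * q)%ofm.

(** Coding of finite sets and sequences as in Simpson, Section II.2: a triple
    [(k, (m, n))] represents the finite set of all [x < k] such that
    [m (x + 1) + 1] divides [n]; the code of a finite set is the least triple
    representing it. *)
Definition triple (c : otm) : ofm :=
  (EX k m n, c = opair k (opair m n))%ofm.

Definition finmem (x c : otm) : ofm :=
  (EX k m n, c = opair k (opair m n) /\
    (x < k /\ divides (m * (x + 1) + 1) n))%ofm.

Definition fincode (c : otm) : ofm :=
  (triple c /\
   (ALL c', c' < c -> triple c' -> ~ (ALL x, finmem x c' <-> finmem x c)))%ofm.

Definition length_is (l h : otm) : ofm :=
  (ALL i, i < h <-> (EX j, finmem (opair i j) l))%ofm.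

(** A finite sequence is coded by the code of its graph. *)
Definition Seq (l : otm) : ofm :=
  (fincode l /\
   ((ALL z, finmem z l -> (EX i j, z = opair i j)) /\
    ((ALL i j k, finmem (opair i j) l -> finmem (opair i k) l -> j = k) /\
     (EX h, length_is l h))))%ofm.

(** [x] belongs to the range [A_l] of the finite sequence [l]. *)
Definition inA (x l : otm) : ofm :=
  (EX h i, length_is l h /\ (i < h /\ finmem (opair i x) l))%ofm.

(** Functions, sequences and bijections are sets of pairs; domain and codomain
    are given as predicates. *)
Definition function (D R : otm -> ofm) (F : oset) : ofm :=
  ((ALL z, z \in F -> (EX i j, z = opair i j /\ (D i /\ R j))) /\
   ((ALL i j k, opair i j \in F -> opair i k \in F -> j = k) /\
    (ALL i, D i -> (EX j, opair i j \in F))))%ofm.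

Definition allN (_ : otm) : ofm := otop.
Definition upto (k : otm) (i : otm) : ofm := (i <= k)%ofm.

Definition bijection (D R : otm -> ofm) (G : oset) : ofm :=
  (function D R G /\
   ((ALL i i' j, opair i j \in G -> opair i' j \in G -> i = i') /\
    (ALL j, R j -> (EX i, opair i j \in G))))%ofm.

(** The domain [[m - 1]], empty for [m = 0], consists of all [j < m]. *)
Definition card_is (A : otm -> ofm) (m : otm) : ofm :=
  (EXSET G, bijection (fun j => j < m)%ofm A G)%ofm.

Definition card_gt (A : otm -> ofm) (m : otm) : ofm :=
  (EX m', m < m' /\ card_is A m')%ofm.

Definition same_value (F : oset) (l l' : otm) : ofm :=
  (EX y, opair l y \in F /\ opair l' y \in F)%ofm.

Definition extensional (F : oset) : ofm :=
  (ALL l l', Seq l -> Seq l' -> (ALL x, inA x l <-> inA x l') ->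
     same_value F l l')%ofm.

Definition nested_with_union (L : oset) : ofm :=
  (function allN allN L /\
   ((ALL m l, opair m l \in L -> Seq l) /\
    ((ALL m l l', opair m l \in L -> opair (m + 1) l' \in L ->
        (ALL x, inA x l -> inA x l')) /\
     (EXSET U, ALL x, x \in U <-> (EX m l, opair m l \in L /\ inA x l)))))%ofm.

Definition AS (F : oset) : ofm :=
  (function allN allN F /\
   (extensional F /\
    (ALLSET L, nested_with_union L ->
       (EX i, ALL j, i <= j ->
          (EX l l', opair i l \in L /\
             (opair j l' \in L /\ same_value F l l'))))))%ofm.

Definition FIPP1 : fm :=
  sentence
    (ALL n, ALLSET F, AS F ->
       (EX k, ALLSET f, function (upto k) (upto n) f ->
          (EX l c, Seq l /\ (upto n c /\
             ((ALL x, inA x l <-> (upto k x /\ opair x c \in f)) /\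
              (EX y, opair l y \in F /\ card_gt (fun x => inA x l) y))))))%ofm.

(* Main.v *)
(** By completeness it suffices to refute FIPP1 in every model of RCA_0.  There
    a bound [h] with [n <= h k], whenever some set of the model maps [{j < n}]
    injectively into [{x < k}], is defined by a bounded formula.

    Color [{0, ..., k}] by parity, but exchange the colors of [k - 1] and [k].
    For [k >= 3] each color class has one element [w >= 2] whose parity differs
    from that of all others, among which is 0 or 1, and the class lies below
    [w + 2].  Let [F] be [h (w + 2)] on the sets of this kind and [h 3] on all
    others; then no color class has more than [F] elements.  If [A] and a
    superset [B] are both of this kind, they have the same [w]; so along an
    increasing sequence [F] changes at most twice, and [F] is asymptotically
    stable. *)

From Stdlib Require Import List Arith Lia Cantor Classical ClassicalEpsilon
  FunctionalExtensionality PropExtensionality ProofIrrelevance Ring.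
Require Import Defs.

(** On a color class [F] has to reach a size that grows with k, yet along an increasing sequence it
    must settle. Hence the class itself has to carry the information about k, and in a way that
    cannot be renewed at larger and larger k as the set grows. Parity alone leaves no trace of k.
    The exchange puts near k one element whose parity stands out, a mark that further elements can
    only preserve or destroy for good.

    The bound h may be far from optimal, because [F] only has to be at least the size of the class.
    With the optimal bound one would need the pigeonhole principle, whose usual induction modifies
    the injection and thus quantifies over injections. Common multiples of the moduli of Gödel's
    beta function give a cruder bound for which the injection stays fixed as a parameter of a
    bounded induction formula. Their defining relation is bounded too, so that [F] exists by
    comprehension. *)

(** * Substitution, free variables and weakening *)

Lemma tsubst_ext f f' t : (forall n, f n = f' n) -> tsubst f t = tsubst f' t.
Proof. intros H; induction t; simpl; congruence. Qed.

Lemma tsubst_tsubst f f' t :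
  tsubst f (tsubst f' t) = tsubst (fun n => tsubst f (f' n)) t.
Proof. induction t; simpl; congruence. Qed.

Lemma tsubst_Var t : tsubst Var t = t.
Proof. induction t; simpl; congruence. Qed.

Lemma subst_ext p : forall f f' g g',
  (forall n, f n = f' n) -> (forall n, g n = g' n) ->
  subst f g p = subst f' g' p.
Proof.
induction p; intros f f' g g' Hf Hg; simpl; f_equal; auto using tsubst_ext.
- apply IHp; [intros [|n]; simpl; congruence | auto].
- apply IHp; [auto | intros [|n]; simpl; congruence].
Qed.

Lemma subst_subst p : forall f g f' g',
  subst f g (subst f' g' p) =
  subst (fun n => tsubst f (f' n)) (fun n => g (g' n)) p.
Proof.
induction p; intros f g f' g'; simpl; rewrite ?tsubst_tsubst; f_equal; auto.
- rewrite IHp; apply subst_ext; [intros [|n]; simpl; auto | auto].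
  unfold tshift; rewrite !tsubst_tsubst; reflexivity.
- rewrite IHp; apply subst_ext; [auto | intros [|n]; reflexivity].
Qed.

Lemma subst_id p : forall f g,
  (forall n, f n = Var n) -> (forall n, g n = n) -> subst f g p = p.
Proof.
induction p; intros f g Hf Hg; simpl; f_equal; auto;
  try (rewrite <- (tsubst_Var s) at 2); try (rewrite <- (tsubst_Var t) at 2);
  auto using tsubst_ext.
- apply IHp; [intros [|n]; simpl; rewrite ?Hf; reflexivity | auto].
- apply IHp; [auto | intros [|n]; simpl; rewrite ?Hg; reflexivity].
Qed.

Fixpoint tbound (t : tm) : nat :=
  match t with
  | Var n => S n
  | Zero | One => 0
  | Add s u | Mul s u => max (tbound s) (tbound u)
  end.

(** A common strict upper bound of the free number and set indices; it is not
    sharp, since it ignores that a quantifier lowers the indices. *)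
Fixpoint fbound (p : fm) : nat :=
  match p with
  | Eq s t | Lt s t => max (tbound s) (tbound t)
  | Mem t X => max (tbound t) (S X)
  | Bot => 0
  | Imp q r => max (fbound q) (fbound r)
  | All1 q | All2 q => fbound q
  end.

Lemma tsubst_ext_bound f f' t :
  (forall n, n < tbound t -> f n = f' n) -> tsubst f t = tsubst f' t.
Proof.
induction t; simpl; intros H; auto; rewrite IHt1, IHt2; auto;
  intros; apply H; lia.
Qed.

Lemma subst_ext_bound p : forall f f' g g',
  (forall n, n < fbound p -> f n = f' n) ->
  (forall n, n < fbound p -> g n = g' n) ->
  subst f g p = subst f' g' p.
Proof.
induction p; intros f f' g g' Hf Hg; simpl in *;
  try (f_equal; try apply tsubst_ext_bound; intros; auto;
       apply Hf || apply Hg; lia).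
- rewrite (IHp1 f f' g g'), (IHp2 f f' g g'); auto; intros;
    apply Hf || apply Hg; lia.
- f_equal; apply IHp; auto; intros [|n] Hn; simpl; auto; rewrite Hf; auto; lia.
- f_equal; apply IHp; auto; intros [|n] Hn; simpl; auto; rewrite Hg; auto; lia.
Qed.

Lemma subst_shift1 f g p :
  subst (scons (Var 0) (fun n => tshift (f n))) g (shift1 p) =
  shift1 (subst f g p).
Proof. unfold shift1; rewrite !subst_subst; apply subst_ext; reflexivity. Qed.

Lemma subst_shift2 f g p :
  subst f (scons 0 (fun n => S (g n))) (shift2 p) = shift2 (subst f g p).
Proof.
unfold shift2; rewrite !subst_subst; apply subst_ext; auto.
intros n; simpl; rewrite tsubst_Var; reflexivity.
Qed.

Lemma subst_inst1 f g t p :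
  subst f g (inst1 t p) =
  inst1 (tsubst f t) (subst (scons (Var 0) (fun n => tshift (f n))) g p).
Proof.
unfold inst1; rewrite !subst_subst; apply subst_ext; auto.
intros [|n]; simpl; auto.
unfold tshift; rewrite tsubst_tsubst; symmetry; apply tsubst_Var.
Qed.

Lemma subst_inst2 f g X p :
  subst f g (inst2 X p) =
  inst2 (g X) (subst f (scons 0 (fun n => S (g n))) p).
Proof.
unfold inst2; rewrite !subst_subst; apply subst_ext.
- intros n; simpl; symmetry; apply tsubst_Var.
- intros [|n]; reflexivity.
Qed.

Lemma prv_weaken T G p : prv T G p -> forall G', incl G G' -> prv T G' p.
Proof.
induction 1; intros G' HG;
  eauto using prv, incl_cons, incl_tl, in_eq, incl_map.
Qed.

(** * Completeness *)

Record structure : Type := Structure {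
  num : Type;
  set : Type;
  zero : num;
  one : num;
  add : num -> num -> num;
  mul : num -> num -> num;
  lt : num -> num -> Prop;
  mem : num -> set -> Prop
}.

Fixpoint eval (M : structure) (e : nat -> num M) (t : tm) : num M :=
  match t with
  | Var n => e n
  | Zero => zero M
  | One => one M
  | Add s u => add M (eval M e s) (eval M e u)
  | Mul s u => mul M (eval M e s) (eval M e u)
  end.

Fixpoint sat (M : structure) (e : nat -> num M) (s : nat -> set M) (p : fm)
  : Prop :=
  match p with
  | Eq t u => eval M e t = eval M e u
  | Lt t u => lt M (eval M e t) (eval M e u)
  | Mem t X => mem M (eval M e t) (s X)
  | Bot => False
  | Imp q r => sat M e s q -> sat M e s r
  | All1 q => forall x, sat M (scons x e) s q
  | All2 q => forall X, sat M e (scons X s) q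
  end.

Definition models (M : structure) (T : fm -> Prop) : Prop :=
  forall p e s, T p -> sat M e s p.

Section Completeness.

Variable T : fm -> Prop.
(** Henkin witnesses will be fresh variables, not new constants. Binding such a variable renames a
    whole derivation, including the axioms in it. *)
Hypothesis T_subst : forall f g p, T p -> T (subst f g p).

Lemma prv_subst G p : prv T G p ->
  forall f g, prv T (map (subst f g) G) (subst f g p).
Proof.
induction 1; intros f g; simpl in *.
- apply prv_ax; auto.
- apply prv_hyp, in_map; auto.
- apply prv_impI, IHprv.
- eapply prv_impE; eauto.
- apply prv_raa, IHprv.
- apply prv_all1I.
  specialize (IHprv (scons (Var 0) (fun n => tshift (f n))) g).
  rewrite map_map in *; erewrite map_ext; [exact IHprv|].
  intros q; symmetry; apply subst_shift1.
- rewrite subst_inst1; apply prv_all1E; auto.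
- apply prv_all2I.
  specialize (IHprv f (scons 0 (fun n => S (g n)))).
  rewrite map_map in *; erewrite map_ext; [exact IHprv|].
  intros q; symmetry; apply subst_shift2.
- rewrite subst_inst2; apply prv_all2E; auto.
- apply prv_eq_refl.
- rewrite subst_inst1 in *; eapply prv_eq_subst; eauto.
  rewrite <- subst_inst1; auto.
Qed.

Definition Con (G : list fm) : Prop := ~ prv T G Bot.

Definition lbound (G : list fm) : nat := fold_right max 0 (map fbound G).

Lemma lbound_in G p : In p G -> fbound p <= lbound G.
Proof.
induction G as [|q G IH]; simpl; [tauto|].
intros [->|H]; [|apply IH in H]; unfold lbound in *; simpl; lia.
Qed.

Lemma prv_generalize1 G q k :
  lbound G <= k -> fbound q <= k -> prv T G (inst1 (Var k) q) ->
  prv T G (All1 q).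
Proof.
intros HG Hq H; apply prv_all1I.
(* The fresh [k] becomes the bound index 0 and all other indices move up by one; below [k], where
   those of [G] and [q] lie, this is [shift1]. *)
pose (f := fun n => if Nat.eqb n k then Var 0 else Var (S n)).
apply (prv_subst _ _) with (f := f) (g := fun X => X) in H.
assert (Hf : forall n, n < k -> f n = Var (S n)).
{ intros n Hn; unfold f; destruct (Nat.eqb_spec n k); auto; lia. }
replace (subst f (fun X => X) (inst1 (Var k) q)) with q in H.
- erewrite map_ext_in; [exact H|].
  intros r Hr; apply lbound_in in Hr.
  apply subst_ext_bound; intros; auto; rewrite Hf; auto; lia.
- unfold inst1; rewrite subst_subst; symmetry.
  transitivity (subst Var (fun X => X) q); [|apply subst_id; auto].
  apply subst_ext_bound; auto.
  intros [|n] Hn; simpl.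
  + unfold f; rewrite Nat.eqb_refl; reflexivity.
  + apply Hf; lia.
Qed.

Lemma prv_generalize2 G q k :
  lbound G <= k -> fbound q <= k -> prv T G (inst2 k q) ->
  prv T G (All2 q).
Proof.
intros HG Hq H; apply prv_all2I.
pose (g := fun n => if Nat.eqb n k then 0 else S n).
apply (prv_subst _ _) with (f := Var) (g := g) in H.
assert (Hg : forall n, n < k -> g n = S n).
{ intros n Hn; unfold g; destruct (Nat.eqb_spec n k); auto; lia. }
replace (subst Var g (inst2 k q)) with q in H.
- erewrite map_ext_in; [exact H|].
  intros r Hr; apply lbound_in in Hr.
  apply subst_ext_bound; intros; auto; rewrite Hg; auto; lia.
- unfold inst2; rewrite subst_subst; symmetry.
  transitivity (subst Var (fun X => X) q); [|apply subst_id; auto].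
  apply subst_ext_bound; auto.
  intros [|n] Hn; simpl.
  + unfold g; rewrite Nat.eqb_refl; reflexivity.
  + apply Hg; lia.
Qed.

(** Existential quantifiers abbreviate negated universal ones, so only these call for a witness. As
    the bounds are strict, their maximum is itself a fresh index. *)
Definition witness (G : list fm) (p : fm) : list fm :=
  let k := max (lbound G) (fbound p) in
  match p with
  | Imp (All1 q) Bot => Neg (inst1 (Var k) q) :: nil
  | Imp (All2 q) Bot => Neg (inst2 k q) :: nil
  | _ => nil
  end.

Lemma Con_witness G p : Con (p :: G) -> Con (witness G p ++ p :: G).
Proof.
intros H.
assert (Hb : forall q, fbound p = fbound q ->
  lbound (p :: G) <= max (lbound G) (fbound p) /\
  fbound q <= max (lbound G) (fbound p)).
{ intros q Hq; unfold lbound; simpl; lia. }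
destruct p as [| | | |[| | | | |q|q] [| | | | | |]| |]; simpl; auto; intros C;
  apply H, prv_impE with (1 := prv_hyp T _ _ (in_eq _ _)); apply prv_raa in C;
  destruct (Hb q) as [H1 H2]; simpl in *; try lia.
- apply prv_generalize1 with (3 := C); simpl in *; lia.
- apply prv_generalize2 with (3 := C); simpl in *; lia.
Qed.

Fixpoint tcode (t : tm) : nat :=
  match t with
  | Var n => to_nat (0, n)
  | Zero => to_nat (1, 0)
  | One => to_nat (2, 0)
  | Add s u => to_nat (3, to_nat (tcode s, tcode u))
  | Mul s u => to_nat (4, to_nat (tcode s, tcode u))
  end.

Fixpoint fcode (p : fm) : nat :=
  match p with
  | Eq s t => to_nat (0, to_nat (tcode s, tcode t))
  | Lt s t => to_nat (1, to_nat (tcode s, tcode t))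
  | Mem t X => to_nat (2, to_nat (tcode t, X))
  | Bot => to_nat (3, 0)
  | Imp q r => to_nat (4, to_nat (fcode q, fcode r))
  | All1 q => to_nat (5, fcode q)
  | All2 q => to_nat (6, fcode q)
  end.

Lemma to_nat_inj p q : to_nat p = to_nat q -> p = q.
Proof. intros H; rewrite <- (cancel_of_to p), H; apply cancel_of_to. Qed.

Ltac split_code :=
  repeat match goal with
  | H : to_nat _ = to_nat _ |- _ =>
      apply to_nat_inj, pair_equal_spec in H as [? H]
  end; try discriminate; subst.

Lemma tcode_inj s : forall t, tcode s = tcode t -> s = t.
Proof.
induction s; intros []; cbn [tcode]; intros; split_code; f_equal; auto.
Qed.

Lemma fcode_inj p : forall q, fcode p = fcode q -> p = q.
Proof.
induction p; intros []; cbn [fcode]; intros; split_code; f_equal;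
  auto using tcode_inj.
Qed.

Section Henkin.

Variable G0 : list fm.
Hypothesis Con_G0 : Con G0.

(** Stage [m + 1] decides the formula with code [m], which is unique by injectivity; the coding
    never has to be inverted. *)
Fixpoint stage (n : nat) : list fm :=
  match n with
  | 0 => G0
  | S m =>
      match excluded_middle_informative
              (exists p, fcode p = m /\ Con (p :: stage m)) with
      | left H => let p := proj1_sig (constructive_indefinite_description _ H)
                  in witness (stage m) p ++ p :: stage m
      | right _ => stage m
      end
  end.

Lemma stage_Con n : Con (stage n).
Proof.
induction n as [|n IH]; simpl; auto.
destruct excluded_middle_informative as [H|H]; auto.
destruct (constructive_indefinite_description _ H) as [p [Hc Hp]]; simpl.
apply Con_witness, Hp.
Qed.

Lemma stage_mono m n : m <= n -> incl (stage m) (stage n).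
Proof.
induction 1 as [|n _ IH]; simpl; [apply incl_refl|].
destruct excluded_middle_informative; auto.
apply incl_appr, incl_tl, IH.
Qed.

Lemma stage_code p :
  Con (p :: stage (fcode p)) ->
  incl (witness (stage (fcode p)) p ++ p :: nil) (stage (S (fcode p))).
Proof.
intros H; simpl; destruct excluded_middle_informative as [E|E].
- destruct constructive_indefinite_description as [q [Hq Hc]]; simpl.
  apply fcode_inj in Hq; subst q.
  apply incl_app; [apply incl_appl, incl_refl|].
  intros a [<-|[]]; apply in_or_app; right; left; reflexivity.
- destruct E; eauto.
Qed.

Definition Th (p : fm) : Prop := exists n, prv T (stage n) p.

Lemma Th_ded l p : (forall q, In q l -> Th q) -> prv T l p -> Th p.
Proof.
intros Hl Hp.
assert (exists n, forall q, In q l -> prv T (stage n) q) as [n Hn].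
{ clear Hp; induction l as [|q l IH].
  - exists 0; intros q [].
  - destruct IH as [n Hn]; [intros; apply Hl; right; auto|].
    destruct (Hl q (or_introl eq_refl)) as [m Hm].
    exists (max m n); intros r [<-|Hr];
      (eapply prv_weaken; [eauto|apply stage_mono; lia]). }
exists n; revert Hn Hp; clear Hl; generalize (stage n); intros G.
revert p; induction l as [|q l IH]; intros p Hn Hp.
- eapply prv_weaken; [eauto|intros ? []].
- eapply prv_impE; [apply IH; [|apply prv_impI, Hp]|]; intros;
    apply Hn; simpl; auto.
Qed.

Lemma Th_Bot : ~ Th Bot.
Proof. intros [n H]; exact (stage_Con n H). Qed.

(** At the stage given by its code, [p] was either consistent and got added, or that stage refutes
    it. *)
Lemma Th_Neg p : ~ Th p -> Th (Neg p).
Proof.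
intros H; destruct (classic (Con (p :: stage (fcode p)))) as [C|C].
- destruct H; exists (S (fcode p)); apply prv_hyp, stage_code; auto.
  apply in_or_app; right; left; reflexivity.
- apply NNPP in C; exists (fcode p); apply prv_impI, C.
Qed.

Lemma Th_hyp p : In p G0 -> Th p.
Proof. intros H; exists 0; apply prv_hyp, H. Qed.

Lemma Th_T p : T p -> Th p.
Proof. intros H; exists 0; apply prv_ax, H. Qed.

Ltac th l := apply (Th_ded l); [simpl; intuition (subst; auto)|].

Lemma Th_Imp p q : Th (Imp p q) <-> (Th p -> Th q).
Proof.
split; intros H.
- intros Hp; th (Imp p q :: p :: nil).
  apply prv_impE with p; apply prv_hyp; simpl; auto.
- destruct (classic (Th p)) as [Hp|Hp].
  + th (q :: nil); apply prv_impI, prv_hyp; simpl; auto.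
  + apply Th_Neg in Hp; th (Neg p :: nil).
    apply prv_impI, prv_raa, prv_impE with p; apply prv_hyp; simpl; auto.
Qed.

Lemma Th_Neg_iff p : Th (Neg p) <-> ~ Th p.
Proof. unfold Neg; rewrite Th_Imp; generalize Th_Bot; tauto. Qed.

Lemma Th_Neg_witness p q :
  Th (Neg p) ->
  In (Neg q) (witness (stage (fcode (Neg p))) (Neg p)) -> Th (Neg q).
Proof.
intros H Hw; destruct (classic (Con (Neg p :: stage (fcode (Neg p)))))
  as [C|C].
- exists (S (fcode (Neg p))); apply prv_hyp, stage_code; auto.
  apply in_or_app; auto.
- apply NNPP in C; apply prv_raa in C.
  apply Th_Neg_iff in H; destruct H; eexists; eauto.
Qed.

Lemma Th_All1 p : Th (All1 p) <-> forall t, Th (inst1 t p).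
Proof.
split; intros H.
- intros t; th (All1 p :: nil); apply prv_all1E, prv_hyp; simpl; auto.
- apply NNPP; intros C; apply Th_Neg in C.
  eapply Th_Neg_witness in C; [|left; reflexivity].
  apply Th_Neg_iff in C; auto.
Qed.

Lemma Th_All2 p : Th (All2 p) <-> forall X, Th (inst2 X p).
Proof.
split; intros H.
- intros t; th (All2 p :: nil); apply prv_all2E, prv_hyp; simpl; auto.
- apply NNPP; intros C; apply Th_Neg in C.
  eapply Th_Neg_witness in C; [|left; reflexivity].
  apply Th_Neg_iff in C; auto.
Qed.

Lemma Th_Eq_refl t : Th (Eq t t).
Proof. th (@nil fm); apply prv_eq_refl. Qed.

Lemma Th_Eq_subst p s t : Th (Eq s t) -> Th (inst1 s p) -> Th (inst1 t p).
Proof.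
intros H1 H2; th (Eq s t :: inst1 s p :: nil).
apply prv_eq_subst with s; apply prv_hyp; simpl; auto.
Qed.

Lemma Th_Eq_transport t p q u v :
  Th (Eq t u) ->
  inst1 t p = v -> inst1 u p = q -> Th v -> Th q.
Proof. intros H <- <-; apply Th_Eq_subst, H. Qed.

Lemma tsubst_tshift t u : tsubst (scons t Var) (tshift u) = u.
Proof. unfold tshift; rewrite tsubst_tsubst; apply tsubst_Var. Qed.

Ltac th_congr H p :=
  eapply (Th_Eq_transport _ p); [exact H|unfold inst1; simpl..|];
  rewrite ?tsubst_tshift; try reflexivity; auto using Th_Eq_refl.

Lemma Th_Eq_sym t u : Th (Eq t u) -> Th (Eq u t).
Proof. intros H; th_congr H (Eq (Var 0) (tshift t)). Qed.

Lemma Th_Eq_trans t u v : Th (Eq t u) -> Th (Eq u v) -> Th (Eq t v).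
Proof. intros H1 H2; th_congr H2 (Eq (tshift t) (Var 0)). Qed.

Lemma Th_Eq_Add t u t' u' :
  Th (Eq t t') -> Th (Eq u u') -> Th (Eq (Add t u) (Add t' u')).
Proof.
intros H1 H2; apply Th_Eq_trans with (Add t' u).
- th_congr H1 (Eq (tshift (Add t u)) (Add (Var 0) (tshift u))).
- th_congr H2 (Eq (tshift (Add t' u)) (Add (tshift t') (Var 0))).
Qed.

Lemma Th_Eq_Mul t u t' u' :
  Th (Eq t t') -> Th (Eq u u') -> Th (Eq (Mul t u) (Mul t' u')).
Proof.
intros H1 H2; apply Th_Eq_trans with (Mul t' u).
- th_congr H1 (Eq (tshift (Mul t u)) (Mul (Var 0) (tshift u))).
- th_congr H2 (Eq (tshift (Mul t' u)) (Mul (tshift t') (Var 0))).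
Qed.

Lemma Th_Lt t u t' u' :
  Th (Eq t t') -> Th (Eq u u') -> Th (Lt t u) -> Th (Lt t' u').
Proof.
intros H1 H2 H; assert (Th (Lt t' u)) by th_congr H1 (Lt (Var 0) (tshift u)).
th_congr H2 (Lt (tshift t') (Var 0)).
Qed.

Lemma Th_Mem t t' X : Th (Eq t t') -> Th (Mem t X) -> Th (Mem t' X).
Proof. intros H1 H; th_congr H1 (Mem (Var 0) X). Qed.

(** Replaces a quotient by provable equality: by extensionality, provably equal terms hand the same
    predicate to [epsilon] and so receive the same representative. *)
Definition rep (t : tm) : tm := epsilon (inhabits t) (fun u => Th (Eq t u)).

Lemma Th_rep t : Th (Eq t (rep t)).
Proof.
exact (epsilon_spec (inhabits t) (fun u => Th (Eq t u))
         (ex_intro _ t (Th_Eq_refl t))).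
Qed.

Lemma rep_eq t u : Th (Eq t u) -> rep t = rep u.
Proof.
intros H; unfold rep.
replace (fun v => Th (Eq u v)) with (fun v => Th (Eq t v)).
- rewrite (proof_irrelevance _ (inhabits t) (inhabits u)); reflexivity.
- extensionality v; apply propositional_extensionality.
  split; eauto using Th_Eq_trans, Th_Eq_sym.
Qed.

Definition cls (t : tm) : {u | rep u = u} :=
  exist _ (rep t) (eq_sym (rep_eq _ _ (Th_rep t))).

Lemma cls_eq t u : cls t = cls u <-> Th (Eq t u).
Proof.
split; intros H.
- injection H as H; apply Th_Eq_trans with (rep t); [apply Th_rep|].
  rewrite H; apply Th_Eq_sym, Th_rep.
- apply eq_sig_hprop; [intros; apply proof_irrelevance|]; apply rep_eq, H.
Qed.

Lemma cls_proj x : cls (proj1_sig x) = x.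
Proof.
apply eq_sig_hprop; [intros; apply proof_irrelevance|]; apply (proj2_sig x).
Qed.

(** The language has no equality between sets, so the set indices serve as sets without any
    identification. *)
Definition term_structure : structure :=
  Structure {u | rep u = u} nat (cls Zero) (cls One)
    (fun x y => cls (Add (proj1_sig x) (proj1_sig y)))
    (fun x y => cls (Mul (proj1_sig x) (proj1_sig y)))
    (fun x y => Th (Lt (proj1_sig x) (proj1_sig y)))
    (fun x X => Th (Mem (proj1_sig x) X)).

Lemma eval_term_structure e t :
  eval term_structure e t = cls (tsubst (fun n => proj1_sig (e n)) t).
Proof.
induction t; simpl; auto.
- symmetry; apply cls_proj.
- rewrite IHt1, IHt2; apply cls_eq; simpl.
  apply Th_Eq_Add; apply Th_Eq_sym, Th_rep.
- rewrite IHt1, IHt2; apply cls_eq; simpl.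
  apply Th_Eq_Mul; apply Th_Eq_sym, Th_rep.
Qed.

Lemma sat_term_structure p : forall e s,
  sat term_structure e s p <-> Th (subst (fun n => proj1_sig (e n)) s p).
Proof.
induction p; intros e r; cbn [sat subst].
- rewrite !eval_term_structure; apply cls_eq.
- rewrite !eval_term_structure; simpl.
  split; apply Th_Lt; auto using Th_rep, Th_Eq_sym.
- rewrite !eval_term_structure; simpl.
  split; apply Th_Mem; auto using Th_rep, Th_Eq_sym.
- generalize Th_Bot; tauto.
- rewrite Th_Imp, IHp1, IHp2; tauto.
- rewrite Th_All1; split; intros H.
  (* The structure contains representatives only; an arbitrary term is reached through its equality
     with its own. *)
  + intros t; apply Th_Eq_subst with (rep t); [apply Th_Eq_sym, Th_rep|].
    specialize (H (cls t)); rewrite IHp in H.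
    unfold inst1; rewrite subst_subst; erewrite subst_ext; [exact H|..]; auto.
    intros [|n]; simpl; auto using tsubst_tshift.
  + intros x; rewrite IHp; specialize (H (proj1_sig x)).
    unfold inst1 in H; rewrite subst_subst in H.
    erewrite subst_ext; [exact H|..]; auto.
    intros [|n]; simpl; auto; rewrite tsubst_tshift; auto.
- rewrite Th_All2; split; intros H Y; specialize (H Y).
  + rewrite IHp in H; unfold inst2; rewrite subst_subst.
    erewrite subst_ext; [exact H|..].
    * intros; apply tsubst_Var.
    * intros [|n]; reflexivity.
  + rewrite IHp; unfold inst2 in H; rewrite subst_subst in H.
    erewrite subst_ext; [exact H|..].
    * intros; symmetry; apply tsubst_Var.
    * intros [|n]; reflexivity.
Qed.

Lemma term_structure_models : models term_structure T.
Proof. intros p e s H; apply sat_term_structure, Th_T, T_subst, H. Qed.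

End Henkin.

(** Invariance under substitution expresses that [p] is closed; the truth lemma then concerns [p]
    itself under any assignment. *)
Theorem completeness p :
  (forall f g, subst f g p = p) ->
  (forall M e s, models M T -> sat M e s p) -> proves T p.
Proof.
intros Hp H; apply NNPP; intros C.
assert (C' : Con (Neg p :: nil)) by (intros D; apply C, prv_raa, D).
assert (HN : Th (Neg p :: nil) p).
{ specialize (H (term_structure (Neg p :: nil))
    (fun _ => cls (Neg p :: nil) Zero) (fun _ => 0)
    (term_structure_models _ C')).
  rewrite (sat_term_structure _ C'), Hp in H; exact H. }
revert HN; apply Th_Neg_iff; auto.
apply Th_hyp; left; reflexivity.
Qed.

End Completeness.

(** * Definability in a model *)

Lemma Sigma00_subst p : Sigma00 p -> forall f g, Sigma00 (subst f g p).
Proof.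
assert (Hs : forall f t, tsubst (scons (Var 0) (fun n => tshift (f n)))
                           (tshift t) = tshift (tsubst f t)).
{ intros; unfold tshift; rewrite !tsubst_tsubst; reflexivity. }
induction 1; intros f g; simpl; rewrite ?Hs;
  (* A bounded existential unfolds to an implication, on which [constructor] would choose
     [Sigma00_imp]. *)
  [constructor; auto..|apply Sigma00_ex; auto].
Qed.

Lemma RCA0_subst f g p : RCA0 p -> RCA0 (subst f g p).
Proof.
intros [q H|q [r H]|q r [q' Hq] [r' Hr]].
- replace (subst f g q) with q; [apply RCA0_basic, H|].
  simpl in H; repeat destruct H as [<-|H]; reflexivity || destruct H.
- assert (E : forall q, subst f g (induction q) =
    induction (subst (scons (Var 0) (fun n => tshift (f n))) g q)).
  { intros p'; unfold induction, And, Neg; cbn [subst].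
    rewrite subst_inst1, !subst_subst; do 6 f_equal.
    apply subst_ext; [|reflexivity].
    intros [|n]; simpl; auto; unfold tshift; rewrite tsubst_tsubst.
    reflexivity. }
  rewrite E; apply RCA0_induction; simpl; constructor.
  apply Sigma00_subst, H.
- assert (E : forall q r, subst f g (comprehension q r) =
    comprehension (subst (scons (Var 0) (fun n => tshift (f n))) g q)
                  (subst (scons (Var 0) (fun n => tshift (f n))) g r)).
  { intros; unfold comprehension, Ex2, Iff, And, Neg; cbn [subst].
    rewrite !subst_shift2; reflexivity. }
  rewrite E; apply RCA0_comprehension; simpl; constructor;
    apply Sigma00_subst; assumption.
Qed.

(** Lets two formulas with unrelated parameters be joined: one moves to the even indices, the other
    to the odd ones. *)
Definition merge {A : Type} (a b : nat -> A) (n : nat) : A :=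
  if Nat.even n then a (Nat.div2 n) else b (Nat.div2 n).

Lemma merge_even A (a b : nat -> A) n : merge a b (2 * n) = a n.
Proof. unfold merge; rewrite Nat.even_even, Nat.div2_double; reflexivity. Qed.

Lemma merge_odd A (a b : nat -> A) n : merge a b (S (2 * n)) = b n.
Proof.
unfold merge; rewrite Nat.even_succ, Nat.odd_even, Nat.div2_succ_double.
reflexivity.
Qed.

Section Semantics.

Variable M : structure.
Variable X0 : set M.

Lemma eval_tsubst f t : forall e,
  eval M e (tsubst f t) = eval M (fun n => eval M e (f n)) t.
Proof. induction t; intros e; simpl; rewrite ?IHt1, ?IHt2; reflexivity. Qed.

Lemma eval_tshift x e t : eval M (scons x e) (tshift t) = eval M e t.
Proof. unfold tshift; rewrite eval_tsubst; reflexivity. Qed.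

Lemma sat_subst p : forall f g e s,
  sat M e s (subst f g p) <->
  sat M (fun n => eval M e (f n)) (fun n => s (g n)) p.
Proof.
induction p; intros f g e r; simpl; rewrite ?eval_tsubst; try tauto.
- rewrite IHp1, IHp2; tauto.
- split; intros H x; specialize (H x); [rewrite IHp in H|rewrite IHp];
    match goal with H : sat M ?e _ _ |- sat M ?e' _ _ =>
      replace e' with e; [exact H|] end;
    extensionality n; destruct n; simpl; rewrite ?eval_tshift; reflexivity.
- split; intros H X; specialize (H X); [rewrite IHp in H|rewrite IHp];
    match goal with H : sat M _ ?s _ |- sat M _ ?s' _ =>
      replace s' with s; [exact H|] end;
    extensionality n; destruct n; reflexivity.
Qed.

Lemma sat_Neg e s p : sat M e s (Neg p) <-> ~ sat M e s p.
Proof. reflexivity. Qed.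

Lemma sat_And e s p q :
  sat M e s (And p q) <-> sat M e s p /\ sat M e s q.
Proof. simpl; tauto. Qed.

Lemma sat_Or e s p q :
  sat M e s (Or p q) <-> sat M e s p \/ sat M e s q.
Proof. simpl; tauto. Qed.

Lemma sat_Iff e s p q :
  sat M e s (Iff p q) <-> (sat M e s p <-> sat M e s q).
Proof. simpl; tauto. Qed.

Lemma sat_Ex1 e s p :
  sat M e s (Ex1 p) <-> exists x, sat M (scons x e) s p.
Proof.
simpl; split; [|firstorder].
intros H; apply NNPP; intros C; apply H; intros x Hx; eauto.
Qed.

Lemma sat_Ex2 e s p :
  sat M e s (Ex2 p) <-> exists X, sat M e (scons X s) p.
Proof.
simpl; split; [|firstorder].
intros H; apply NNPP; intros C; apply H; intros x Hx; eauto.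
Qed.

Notation N := (num M).

(** Each index of a formula stands for a variable [inl i] or for a parameter
    [inr a] from the structure. *)
Definition lookup (r : nat -> nat + N) (e : nat -> N) (n : nat) : N :=
  match r n with inl i => e i | inr a => a end.

Definition DefT (t : (nat -> N) -> N) : Prop :=
  exists u r, forall e, eval M (lookup r e) u = t e.

(** Bounded definability with parameters, stated for predicates on assignments. Its closure
    properties follow the shape of the predicate, so that no de Bruijn formula has to be written
    down. *)
Definition Def (P : (nat -> N) -> Prop) : Prop :=
  exists p r s, Sigma00 p /\ forall e, sat M (lookup r e) s p <-> P e.

Lemma lookup_even r r' e :
  (fun n => lookup (merge r r') e (2 * n)) = lookup r e.
Proof. extensionality n; unfold lookup; rewrite merge_even; reflexivity. Qed.

Lemma lookup_odd r r' e :
  (fun n => lookup (merge r r') e (S (2 * n))) = lookup r' e.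
Proof. extensionality n; unfold lookup; rewrite merge_odd; reflexivity. Qed.

Lemma DefT_var i : DefT (fun e => e i).
Proof. exists (Var 0), (fun _ => inl i); reflexivity. Qed.

Lemma DefT_const a : DefT (fun _ => a).
Proof. exists (Var 0), (fun _ => inr a); reflexivity. Qed.

Lemma DefT_op (c : tm -> tm -> tm) (o : N -> N -> N) t u :
  (forall e v w, eval M e (c v w) = o (eval M e v) (eval M e w)) ->
  DefT t -> DefT u -> DefT (fun e => o (t e) (u e)).
Proof.
intros Ho [t' [r H]] [u' [r' H']].
exists (c (tsubst (fun n => Var (2 * n)) t')
          (tsubst (fun n => Var (S (2 * n))) u')), (merge r r').
intros e; rewrite Ho, !eval_tsubst; cbn [eval].
rewrite lookup_even, lookup_odd, H, H'; reflexivity.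
Qed.

Lemma DefT_add t u :
  DefT t -> DefT u -> DefT (fun e => add M (t e) (u e)).
Proof. apply DefT_op with (c := Add); reflexivity. Qed.

Lemma DefT_mul t u :
  DefT t -> DefT u -> DefT (fun e => mul M (t e) (u e)).
Proof. apply DefT_op with (c := Mul); reflexivity. Qed.

Lemma DefT_shift t : DefT t -> DefT (fun e => t (fun n => e (S n))).
Proof.
intros [u [r H]].
exists u, (fun n => match r n with inl i => inl (S i) | inr a => inr a end).
intros e; rewrite <- H; f_equal; extensionality n; unfold lookup.
destruct (r n); reflexivity.
Qed.

Lemma Def_shift P : Def P -> Def (fun e => P (fun n => e (S n))).
Proof.
intros [p [r [s [Hp H]]]].
exists p, (fun n => match r n with inl i => inl (S i) | inr a => inr a end), s.
split; auto; intros e; rewrite <- H.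
match goal with |- sat M ?e _ _ <-> sat M ?e' _ _ => replace e' with e end;
  [reflexivity|].
extensionality n; unfold lookup; destruct (r n); reflexivity.
Qed.

Lemma Def_ext P Q : (forall e, P e <-> Q e) -> Def P -> Def Q.
Proof.
intros E [p [r [s [Hp H]]]]; exists p, r, s; split; auto.
intros e; rewrite <- E; auto.
Qed.

Lemma Def_rel (c : tm -> tm -> fm) (o : N -> N -> Prop) t u :
  (forall v w, Sigma00 (c v w)) ->
  (forall e s v w, sat M e s (c v w) <-> o (eval M e v) (eval M e w)) ->
  DefT t -> DefT u -> Def (fun e => o (t e) (u e)).
Proof.
intros Hc Ho [t' [r H]] [u' [r' H']].
exists (c (tsubst (fun n => Var (2 * n)) t')
          (tsubst (fun n => Var (S (2 * n))) u')), (merge r r'), (fun _ => X0).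
split; auto.
intros e; rewrite Ho, !eval_tsubst; cbn [eval].
rewrite lookup_even, lookup_odd, H, H'; reflexivity.
Qed.

Lemma Def_mem t X : DefT t -> Def (fun e => mem M (t e) X).
Proof.
intros [u [r H]]; exists (Mem u 0), r, (fun _ => X).
split; [constructor|]; intros e; simpl; rewrite H; reflexivity.
Qed.

Lemma Def_imp P Q : Def P -> Def Q -> Def (fun e => P e -> Q e).
Proof.
intros [p [r [s [Hp H]]]] [p' [r' [s' [Hp' H']]]].
exists (Imp (subst (fun n => Var (2 * n)) (fun n => 2 * n) p)
  (subst (fun n => Var (S (2 * n))) (fun n => S (2 * n)) p')),
  (merge r r'), (merge s s').
split; [constructor; apply Sigma00_subst; assumption|].
intros e; cbn [sat]; rewrite !sat_subst; cbn [eval].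
rewrite lookup_even, lookup_odd.
replace (fun n => merge s s' (2 * n)) with s;
  [|extensionality n; symmetry; apply merge_even].
replace (fun n => merge s s' (S (2 * n))) with s';
  [|extensionality n; symmetry; apply merge_odd].
rewrite H, H'; reflexivity.
Qed.

Lemma Def_all t (Q : N -> (nat -> N) -> Prop) :
  DefT t -> Def (fun e => Q (e 0) (fun n => e (S n))) ->
  Def (fun e => forall x, lt M x (t e) -> Q x e).
Proof.
intros [u [r H]] [p [r' [s [Hp H']]]].
exists (All1 (Imp (Lt (Var 0) (tshift (tsubst (fun n => Var (2 * n)) u)))
  (* Only indices standing for the quantified variable become [Var 0]. The others go to the odd half
     of the merged assignment, one higher because of the binder; there variable [i] is recorded as
     [pred i], its index outside. *)
  (subst (fun n => match r' n with
                   | inl 0 => Var 0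
                   | _ => Var (S (S (2 * n)))
                   end) (fun n => n) p))),
  (merge r (fun n => match r' n with inl i => inl (pred i) | a => a end)), s.
split; [constructor; apply Sigma00_subst, Hp|].
intros e; cbn [sat eval].
match goal with |- context [lookup ?r] => set (r0 := r) end.
assert (E : forall x, (fun n => eval M (scons x (lookup r0 e))
    (match r' n with inl 0 => Var 0 | _ => Var (S (S (2 * n))) end))
  = lookup r' (scons x e)).
{ intros x; extensionality n; unfold lookup at 2.
  destruct (r' n) as [[|i]|a] eqn:En; cbn [eval scons]; auto;
    unfold lookup, r0; rewrite merge_odd, En; reflexivity. }
assert (E' : forall x,
  eval M (scons x (lookup r0 e)) (tshift (tsubst (fun n => Var (2 * n)) u))
  = t e).
{ intros x; rewrite eval_tshift, eval_tsubst; cbn [eval]; unfold r0.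
  rewrite lookup_even; apply H. }
split; intros HQ x; specialize (HQ x).
- rewrite E', sat_subst, E, H' in HQ; exact HQ.
- rewrite E', sat_subst, E, H'; exact HQ.
Qed.

Lemma Def_eq t u : DefT t -> DefT u -> Def (fun e => t e = u e).
Proof. apply Def_rel with (c := Eq); [constructor|reflexivity]. Qed.

Lemma Def_lt t u : DefT t -> DefT u -> Def (fun e => lt M (t e) (u e)).
Proof. apply Def_rel with (c := Lt); [constructor|reflexivity]. Qed.

Lemma Def_bot : Def (fun _ => False).
Proof.
exists Bot, (fun _ => inl 0), (fun _ => X0).
split; [constructor|reflexivity].
Qed.

Lemma Def_not P : Def P -> Def (fun e => ~ P e).
Proof. intros H; apply Def_imp; [exact H|exact Def_bot]. Qed.

Lemma Def_and P Q : Def P -> Def Q -> Def (fun e => P e /\ Q e).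
Proof.
intros HP HQ; apply Def_ext with (fun e => ~ (P e -> ~ Q e)).
- intros e; tauto.
- auto using Def_not, Def_imp.
Qed.

Lemma Def_or P Q : Def P -> Def Q -> Def (fun e => P e \/ Q e).
Proof.
intros HP HQ; apply Def_ext with (fun e => ~ P e -> Q e).
- intros e; tauto.
- auto using Def_not, Def_imp.
Qed.

Lemma Def_iff P Q : Def P -> Def Q -> Def (fun e => P e <-> Q e).
Proof. intros HP HQ; apply Def_and; auto using Def_imp. Qed.

Lemma Def_ex t (Q : N -> (nat -> N) -> Prop) :
  DefT t -> Def (fun e => Q (e 0) (fun n => e (S n))) ->
  Def (fun e => exists x, lt M x (t e) /\ Q x e).
Proof.
intros Ht HQ.
apply Def_ext with (fun e => ~ forall x, lt M x (t e) -> ~ Q x e).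
- intros e; split; [|firstorder].
  intros H; apply NNPP; intros C; apply H; eauto.
- apply Def_not, Def_all; auto using Def_not.
Qed.

Hypothesis HM : models M RCA0.

(** Brings a definable relation into the shape of the axiom schemes: variables at indices 0 and 1,
    parameters above them. *)
Lemma Def_formula2 (Q : N -> N -> Prop) :
  Def (fun e => Q (e 0) (e 1)) ->
  exists p e s, Sigma00 p /\
    forall y x, sat M (scons y (scons x e)) s p <-> Q y x.
Proof.
intros [p [r [s [Hp H]]]].
exists (subst (fun n => match r n with
                        | inl 0 => Var 0
                        | inl 1 => Var 1
                        | _ => Var (S (S n))
                        end) (fun n => n) p).
exists (fun n => match r n with inl _ => zero M | inr a => a end), s.
split; [apply Sigma00_subst, Hp|].
intros y x; rewrite sat_subst.
rewrite <- (H (scons y (scons x (fun _ => zero M)))).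
match goal with |- sat M ?e _ _ <-> sat M ?e' _ _ => replace e with e' end;
  [reflexivity|].
extensionality n; unfold lookup.
destruct (r n) as [[|[|i]]|a] eqn:E; simpl; rewrite ?E; reflexivity.
Qed.

Lemma induction_ex (Q : N -> N -> Prop) :
  Def (fun e => Q (e 0) (e 1)) ->
  (exists y, Q y (zero M)) ->
  (forall x, (exists y, Q y x) -> exists y, Q y (add M x (one M))) ->
  forall x, exists y, Q y x.
Proof.
intros HQ H0 HS; destruct (Def_formula2 Q HQ) as [p [e [s [Hp H]]]].
assert (E : forall x, sat M (scons x e) s (Ex1 p) <-> exists y, Q y x).
{ intros x; rewrite sat_Ex1; firstorder. }
generalize (HM _ e s (RCA0_induction _ (Sigma01_ex _ Hp))).
unfold induction; cbn [sat]; intros HI x; apply E, HI.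
apply sat_And; split.
- unfold inst1; rewrite sat_subst.
  match goal with |- sat M ?e' _ _ => replace e' with (scons (zero M) e) end.
  + apply E, H0.
  + extensionality n; destruct n; reflexivity.
- intros y Hy; rewrite sat_subst.
  match goal with |- sat M ?e' _ _ =>
    replace e' with (scons (add M y (one M)) e) end.
  + apply E, HS, E, Hy.
  + extensionality n; destruct n; reflexivity.
Qed.

Lemma induction0 (P : N -> Prop) :
  Def (fun e => P (e 0)) ->
  P (zero M) -> (forall x, P x -> P (add M x (one M))) -> forall x, P x.
Proof.
intros HP H0 HS x.
(* A vacuous existential quantifier makes the formula Sigma01. *)
destruct (induction_ex (fun _ => P)) with (x := x) as [_ H]; auto.
- exact (Def_shift _ HP).
- exists (zero M); exact H0.
- intros y [_ Hy]; exists (zero M); auto.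
Qed.

(** Vacuous quantifiers in front of one bounded formula supply both the Sigma01 and the Pi01 form
    required by the scheme. *)
Lemma comprehension0 (P : N -> Prop) :
  Def (fun e => P (e 0)) -> exists X, forall x, mem M x X <-> P x.
Proof.
intros HP; destruct (Def_formula2 (fun _ => P) (Def_shift _ HP))
  as [p [e [s [Hp H]]]].
assert (E1 : forall x, sat M (scons x e) s (Ex1 p) <-> P x).
{ intros x; rewrite sat_Ex1; split; [intros [y Hy]; eapply H, Hy|].
  intros Hx; exists x; apply H, Hx. }
assert (E2 : forall x, sat M (scons x e) s (All1 p) <-> P x).
{ intros x; split; intros Hx; [apply (H x), Hx|].
  intros y; apply H, Hx. }
generalize (HM _ e s
  (RCA0_comprehension _ _ (Sigma01_ex _ Hp) (Pi01_all _ Hp))).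
unfold comprehension; intros HC; specialize (HC ltac:(intros x;
  apply sat_Iff; rewrite E1, E2; reflexivity)).
apply sat_Ex2 in HC as [X HX]; exists X; intros x.
specialize (HX x); apply sat_Iff in HX; cbn [sat eval scons] in HX; rewrite HX.
rewrite <- E1; unfold shift2; rewrite sat_subst; reflexivity.
Qed.

Definition le (x y : N) : Prop := lt M x y \/ x = y.

Declare Scope num_scope.
Local Notation "0" := (zero M) : num_scope.
Local Notation "1" := (one M) : num_scope.
Local Notation "x + y" := (add M x y) : num_scope.
Local Notation "x * y" := (mul M x y) : num_scope.
Local Notation "x < y" := (lt M x y) : num_scope.
Local Notation "x <= y" := (le x y) : num_scope.
Local Open Scope num_scope.

Lemma Def_le t u : DefT t -> DefT u -> Def (fun e => t e <= u e).
Proof. intros Ht Hu; apply Def_or; auto using Def_lt, Def_eq. Qed.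

Create HintDb def.

(** Every quantifier passed shifts the parameters; the iterated [DefT_shift] reaches a hypothesis
    from under up to four of them. *)
Ltac defT :=
  cbn beta;
  first
  [ apply DefT_const
  | apply DefT_var
  | apply DefT_add; defT
  | apply DefT_mul; defT
  | match goal with
    | H : DefT ?t |- _ =>
        first [ exact H | exact (DefT_shift _ H)
              | exact (DefT_shift _ (DefT_shift _ H))
              | exact (DefT_shift _ (DefT_shift _ (DefT_shift _ H)))
              | exact (DefT_shift _ (DefT_shift _ (DefT_shift _
                                                      (DefT_shift _ H)))) ]
    end
  | solve [auto with def] ].

Ltac def :=
  cbn beta;
  lazymatch goal with
  | |- DefT _ => defT
  | |- Def (fun e => ~ _) => apply Def_not; def
  | |- Def (fun e => _ = _) => apply Def_eq; defT
  | |- Def (fun e => lt M _ _) => apply Def_lt; defT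
  | |- Def (fun e => le _ _) => apply Def_le; defT
  | |- Def (fun e => mem M _ _) => apply Def_mem; defT
  | |- Def (fun e => _ /\ _) => apply Def_and; def
  | |- Def (fun e => _ \/ _) => apply Def_or; def
  | |- Def (fun e => _ <-> _) => apply Def_iff; def
  | |- Def (fun e => exists x, _) => apply Def_ex; def
  | |- Def (fun e => forall x : N, _) => apply Def_all; def
  | |- Def (fun e => _ -> _) => apply Def_imp; def
  | _ => solve [auto with def]
  end.

Ltac num_ind x :=
  pattern x; apply induction0; clear x; [def| |intros x IH].

(** * Arithmetic in a model *)

Lemma add1_neq0 x : x + 1 <> 0.
Proof.
refine (HM (nth 0 basic_axioms Bot) (fun _ => 0) (fun _ => X0) _ x).
apply RCA0_basic; simpl; auto 12.
Qed.

Lemma add1_inj x y : x + 1 = y + 1 -> x = y.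
Proof.
refine (HM (nth 1 basic_axioms Bot) (fun _ => 0) (fun _ => X0) _ x y).
apply RCA0_basic; simpl; auto 12.
Qed.

Lemma add0r x : x + 0 = x.
Proof.
refine (HM (nth 2 basic_axioms Bot) (fun _ => 0) (fun _ => X0) _ x).
apply RCA0_basic; simpl; auto 12.
Qed.

Lemma addSr x y : x + (y + 1) = (x + y) + 1.
Proof.
refine (HM (nth 3 basic_axioms Bot) (fun _ => 0) (fun _ => X0) _ x y).
apply RCA0_basic; simpl; auto 12.
Qed.

Lemma mul0r x : x * 0 = 0.
Proof.
refine (HM (nth 4 basic_axioms Bot) (fun _ => 0) (fun _ => X0) _ x).
apply RCA0_basic; simpl; auto 12.
Qed.

Lemma mulSr x y : x * (y + 1) = x * y + x.
Proof.
refine (HM (nth 5 basic_axioms Bot) (fun _ => 0) (fun _ => X0) _ x y).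
apply RCA0_basic; simpl; auto 12.
Qed.

Lemma nlt0 x : ~ x < 0.
Proof.
refine (HM (nth 6 basic_axioms Bot) (fun _ => 0) (fun _ => X0) _ x).
apply RCA0_basic; simpl; auto 12.
Qed.

Lemma ltS x y : x < y + 1 <-> x <= y.
Proof.
assert (H : RCA0 (nth 7 basic_axioms Bot))
  by (apply RCA0_basic; simpl; auto 12).
specialize (HM _ (fun _ => 0) (fun _ => X0) H x y); apply sat_Iff in HM.
etransitivity; [exact HM|apply sat_Or].
Qed.

Lemma add_assoc x y z : x + (y + z) = (x + y) + z.
Proof.
num_ind z; [rewrite !add0r; reflexivity|].
rewrite !addSr, IH; reflexivity.
Qed.

Lemma add0l x : 0 + x = x.
Proof. num_ind x; [apply add0r|rewrite addSr, IH; reflexivity]. Qed.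

Lemma addSl x y : (x + 1) + y = (x + y) + 1.
Proof.
num_ind y; [rewrite !add0r; reflexivity|rewrite !addSr, IH; reflexivity].
Qed.

Lemma add_comm x y : x + y = y + x.
Proof.
num_ind y; [rewrite add0r, add0l; reflexivity|].
rewrite addSr, addSl, IH; reflexivity.
Qed.

Lemma mul0l x : 0 * x = 0.
Proof. num_ind x; [apply mul0r|rewrite mulSr, IH, add0r; reflexivity]. Qed.

Lemma mulSl x y : (x + 1) * y = x * y + y.
Proof.
num_ind y; [rewrite !mul0r, add0r; reflexivity|].
rewrite !mulSr, IH, !addSr; f_equal.
rewrite <- !add_assoc, (add_comm y); reflexivity.
Qed.

Lemma mul_comm x y : x * y = y * x.
Proof.
num_ind y; [rewrite mul0r, mul0l; reflexivity|].
rewrite mulSr, mulSl, IH; reflexivity.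
Qed.

Lemma mul1l x : 1 * x = x.
Proof. rewrite <- (add0l 1), mulSl, mul0l; apply add0l. Qed.

Lemma mul_add_distr x y z : (x + y) * z = x * z + y * z.
Proof.
num_ind z; [rewrite !mul0r, add0r; reflexivity|].
rewrite !mulSr, IH, <- !add_assoc; f_equal.
rewrite !add_assoc, (add_comm x); reflexivity.
Qed.

Lemma mul_assoc x y z : x * (y * z) = (x * y) * z.
Proof.
num_ind z; [rewrite !mul0r; reflexivity|].
rewrite !mulSr, <- IH.
rewrite (mul_comm x), mul_add_distr, (mul_comm x), (mul_comm x); reflexivity.
Qed.

Lemma num_semi_ring :
  semi_ring_theory (zero M) (one M) (add M) (mul M) (@eq N).
Proof.
constructor; auto using add0l, add_comm, add_assoc, mul1l, mul0l, mul_comm,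
  mul_assoc, mul_add_distr.
Qed.

Add Ring num_ring : num_semi_ring.

Lemma add_cancel_r x y z : x + z = y + z -> x = y.
Proof.
num_ind z; [rewrite !add0r; auto|].
rewrite !addSr; intros H; apply IH, add1_inj, H.
Qed.

Lemma add_cancel_l x y z : z + x = z + y -> x = y.
Proof. rewrite !(add_comm z); apply add_cancel_r. Qed.

Lemma zero_or_succ x : x = 0 \/ exists y, x = y + 1.
Proof.
(* The quantifier has to precede the disjunction for [induction_ex] to apply. *)
enough (exists y, x = 0 \/ x = y + 1) as [y [H|H]] by eauto.
pattern x; apply (induction_ex (fun y x => x = 0 \/ x = y + 1)); [def|..].
- exists 0; auto.
- intros z _; exists z; auto.
Qed.

(** Turns the order into equations, which [ring] can handle. *)
Lemma lt_iff x y : x < y <-> exists z, y = x + z + 1.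
Proof.
split.
- intros H; enough (exists z, x < y -> y = x + z + 1) as [z Hz] by eauto.
  clear H; pattern y.
  apply (induction_ex (fun z y => x < y -> y = x + z + 1)); [def|..].
  + exists 0; intros H; destruct (nlt0 _ H).
  + intros u [z Hz]; destruct (classic (x < u)) as [H|H].
    * exists (z + 1); intros _; rewrite (Hz H) at 1; ring.
    * exists 0; intros Hu; apply ltS in Hu as [Hu| <-]; [tauto|ring].
- intros [z ->]; num_ind z.
  + apply ltS; right; ring.
  + apply ltS; left; rewrite add_assoc; exact IH.
Qed.

Lemma le_iff x y : x <= y <-> exists z, y = x + z.
Proof.
split.
- intros [H| ->]; [apply lt_iff in H as [z ->]|].
  + exists (z + 1); ring.
  + exists 0; ring.
- intros [z ->]; destruct (zero_or_succ z) as [->|[u ->]].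
  + right; ring.
  + left; apply lt_iff; exists u; ring.
Qed.

Lemma le_refl x : x <= x.
Proof. right; reflexivity. Qed.

Lemma lt_le x y : x < y -> x <= y.
Proof. left; assumption. Qed.

Lemma le_trans x y z : x <= y -> y <= z -> x <= z.
Proof.
rewrite !le_iff; intros [a ->] [b ->]; exists (a + b); ring.
Qed.

Lemma lt_succ_le x y : x < y <-> x + 1 <= y.
Proof.
rewrite lt_iff, le_iff; split; intros [z ->]; exists z; ring.
Qed.

Lemma lt_le_trans x y z : x < y -> y <= z -> x < z.
Proof. rewrite !lt_succ_le; apply le_trans. Qed.

Lemma le_lt_trans x y z : x <= y -> y < z -> x < z.
Proof.
rewrite le_iff, !lt_iff; intros [a ->] [b ->]; exists (a + b); ring.
Qed.

Lemma lt_trans x y z : x < y -> y < z -> x < z.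
Proof. intros H; apply le_lt_trans, lt_le, H. Qed.

Lemma lt_irrefl x : ~ x < x.
Proof.
rewrite lt_iff; intros [z H]; apply (add1_neq0 z), (add_cancel_l _ _ x).
rewrite add_assoc, <- H; ring.
Qed.

Lemma le_not_lt x y : x <= y -> ~ y < x.
Proof. intros H1 H2; apply (lt_irrefl x), (le_lt_trans _ _ _ H1 H2). Qed.

Lemma le_antisym x y : x <= y -> y <= x -> x = y.
Proof. intros [H|H]; auto; intros C; destruct (le_not_lt _ _ C H). Qed.

Lemma le0 x : 0 <= x.
Proof. apply le_iff; exists x; ring. Qed.

Lemma lt_succ x : x < x + 1.
Proof. apply ltS, le_refl. Qed.

Lemma le_add_l x y : x <= x + y.
Proof. apply le_iff; exists y; reflexivity. Qed.

Lemma le_add_r x y : y <= x + y.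
Proof. apply le_iff; exists x; ring. Qed.

Lemma pos_neq0 x : 0 < x <-> x <> 0.
Proof.
split; [intros H ->; destruct (lt_irrefl _ H)|].
destruct (zero_or_succ x) as [->|[y ->]]; [tauto|intros _].
apply ltS, le0.
Qed.

Lemma le_or_lt x y : x <= y \/ y < x.
Proof.
enough (exists z, y = x + z \/ x = y + z + 1) as [z [H|H]].
- left; apply le_iff; eauto.
- right; apply lt_iff; eauto.
- pattern y; apply (induction_ex (fun z y => y = x + z \/ x = y + z + 1));
    [def|..].
  + destruct (zero_or_succ x) as [->|[z ->]].
    * exists 0; left; ring.
    * exists z; right; ring.
  + intros u [z [->|H]].
    * exists (z + 1); left; ring.
    * destruct (zero_or_succ z) as [->|[v ->]]; subst x.
      -- exists 0; left; ring.
      -- exists v; right; ring.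
Qed.

Lemma lt_trichotomy x y : x < y \/ x = y \/ y < x.
Proof. destruct (le_or_lt x y) as [[H|H]|H]; auto. Qed.

Lemma add_le x y z w : x <= y -> z <= w -> x + z <= y + w.
Proof.
rewrite !le_iff; intros [a ->] [b ->]; exists (a + b); ring.
Qed.

Lemma mul_le x y z w : x <= y -> z <= w -> x * z <= y * w.
Proof.
rewrite !le_iff; intros [a ->] [b ->]; exists (x * b + a * z + a * b); ring.
Qed.

Lemma add_lt_cancel_r x y z : x + z < y + z -> x < y.
Proof.
rewrite !lt_iff; intros [a H]; exists a; apply (add_cancel_r _ _ z).
rewrite H; ring.
Qed.

Lemma mul_pos x y : 0 < x -> 0 < y -> 0 < x * y.
Proof.
rewrite !lt_iff; intros [a ->] [b ->]; exists (a * b + a + b); ring.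
Qed.

Lemma mul_eq0 x y : x * y = 0 -> x = 0 \/ y = 0.
Proof.
intros H; apply NNPP; intros C; apply not_or_and in C as [Hx Hy].
apply pos_neq0 in Hx, Hy; apply (lt_irrefl 0).
rewrite <- H at 2; apply mul_pos; assumption.
Qed.

(** * Pairing, divisibility and coprime moduli *)

Definition pair (i j : N) : N := (i + j) * (i + j) + i.

Lemma le_square x : x <= x * x.
Proof.
destruct (zero_or_succ x) as [->|[y ->]]; [right; ring|].
apply le_iff; exists (y * y + y); ring.
Qed.

Lemma pair_ge_l i j : i <= pair i j.
Proof. apply le_add_r. Qed.

Lemma pair_ge_r i j : j <= pair i j.
Proof.
apply le_trans with ((i + j) * (i + j)); [|apply le_add_l].
apply le_trans with (i + j); [apply le_add_r|apply le_square].
Qed.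

(** [pair i j] is at least the square of [i + j] and less than that of [i + j + 1]. *)
Lemma pair_lt i j i' j' : i + j < i' + j' -> pair i j < pair i' j'.
Proof.
intros H; apply lt_succ_le in H; unfold pair.
apply lt_le_trans with ((i' + j') * (i' + j')); [|apply le_add_l].
apply lt_le_trans with ((i + j + 1) * (i + j + 1)).
- apply lt_iff; exists (i + j + j); ring.
- apply mul_le; assumption.
Qed.

Lemma pair_inj i j i' j' : pair i j = pair i' j' -> i = i' /\ j = j'.
Proof.
intros H; destruct (lt_trichotomy (i + j) (i' + j')) as [C|[C|C]].
- apply pair_lt in C; rewrite H in C; destruct (lt_irrefl _ C).
- unfold pair in H; rewrite C in H; apply add_cancel_l in H as ->.
  split; [reflexivity|apply add_cancel_l in C; exact C].
- apply pair_lt in C; rewrite H in C; destruct (lt_irrefl _ C).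
Qed.

Definition div (p a : N) : Prop := exists q, a = p * q.

Lemma div_add_cancel p a b : div p (a + b) -> div p a -> div p b.
Proof.
intros [q Hq] [r ->]; destruct (le_or_lt r q) as [H|H].
- apply le_iff in H as [d ->]; exists d.
  apply (add_cancel_l _ _ (p * r)); rewrite Hq; ring.
- apply lt_le, le_iff in H as [d ->]; exists 0.
  rewrite mul0r; assert (E : p * d + b = 0).
  { apply (add_cancel_l _ _ (p * q)); rewrite add0r; rewrite <- Hq at 2; ring. }
  destruct (zero_or_succ b) as [->|[c ->]]; auto.
  destruct (add1_neq0 (p * d + c)); rewrite <- E; ring.
Qed.

Lemma div_mul_r p a b : div p a -> div p (a * b).
Proof. intros [q ->]; exists (q * b); ring. Qed.

(** With a positive divisor the quotient is at most the dividend, so divisibility becomes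
    bounded. *)
Lemma div_quotient_le p a :
  0 < p -> div p a <-> exists q, q < a + 1 /\ a = p * q.
Proof.
intros Hp; split; [|intros [q [_ Hq]]; exists q; exact Hq].
intros [q Hq]; exists q; split; auto; apply ltS.
rewrite Hq; rewrite <- (mul1l q) at 1; apply mul_le; [|apply le_refl].
rewrite lt_succ_le, add0l in Hp; exact Hp.
Qed.

Lemma Def_div p a :
  (forall e, 0 < p e) -> DefT p -> DefT a -> Def (fun e => div (p e) (a e)).
Proof.
intros Hp H1 H2.
apply Def_ext with (fun e => exists q, q < a e + 1 /\ a e = p e * q).
- intros e; symmetry; apply div_quotient_le, Hp.
- def.
Qed.

(** The moduli of Gödel's beta function. *)
Definition modulus (m x : N) : N := m * (x + 1) + 1.

Lemma modulus_pos m x : 0 < modulus m x.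
Proof. apply ltS, le0. Qed.

Lemma Def_div_modulus m x a :
  DefT m -> DefT x -> DefT a -> Def (fun e => div (modulus (m e) (x e)) (a e)).
Proof.
intros Hm Hx Ha; apply Def_div; auto using modulus_pos.
unfold modulus; def.
Qed.

Lemma Def_div_succ x a :
  DefT x -> DefT a -> Def (fun e => div (x e + 1) (a e)).
Proof. intros; apply Def_div; [intros; apply ltS, le0|def|def]. Qed.

Hint Extern 1 (DefT _) => defT : def.
Hint Resolve Def_div_modulus Def_div_succ : def.

(** If [m (y + 1) + 1] divides [a], it divides [a] times the square of
    [m (y + 1)], which is 1 modulo it. *)
Lemma div_modulus_cancel m y a :
  0 < m ->
  div (modulus m y) (a * (m * (y + 1)) * (m * (y + 1))) -> div (modulus m y) a.
Proof.
intros Hm H.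
assert (exists r, m * (y + 1) = r + 1) as [r Hr].
{ destruct (zero_or_succ (m * (y + 1))) as [E|E]; auto.
  apply mul_eq0 in E as [->|E]; [destruct (lt_irrefl _ Hm)|].
  destruct (add1_neq0 _ E). }
unfold modulus in *; rewrite Hr in *.
(* The modulus is r + 2, and a (r + 1)^2 = (r + 2) (a r) + a. The square replaces the residue -1 by
   1, as there is no subtraction. *)
apply div_add_cancel with ((r + 1 + 1) * (a * r)).
- destruct H as [q H]; exists q; rewrite <- H; ring.
- exists (a * r); reflexivity.
Qed.

(** Let d + 1 be the distance between [x] and [y]. The moduli differ by m (d + 1), so [modulus m y]
    divides a m (d + 1). Since d + 1 divides [m], it also divides a (m (y + 1))^2, and the square
    cancels. Neither gcd nor primes enter. *)
Lemma modulus_coprime m k x y a :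
  0 < m -> (forall d, d < k -> div (d + 1) m) ->
  x < k -> y < k -> x <> y ->
  div (modulus m y) (modulus m x * a) -> div (modulus m y) a.
Proof.
intros Hm Hk Hx Hy Hxy H; apply (div_modulus_cancel _ _ _ Hm).
destruct (lt_trichotomy x y) as [C|[C|C]]; [|tauto|];
  apply lt_iff in C as [d ->].
- destruct (Hk d) as [c Hc].
  { eapply le_lt_trans; [|exact Hy]; apply le_iff; exists (x + 1); ring. }
  replace (a * (m * (x + d + 1 + 1)) * (m * (x + d + 1 + 1))) with
    (a * (m * (d + 1)) * (c * (x + d + 1 + 1) * (x + d + 1 + 1)))
    by (rewrite Hc; ring).
  apply div_mul_r, div_add_cancel with (modulus m x * a); [|exact H].
  exists a; unfold modulus; ring.
- destruct (Hk d) as [c Hc].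
  { eapply le_lt_trans; [|exact Hx]; apply le_iff; exists (y + 1); ring. }
  replace (a * (m * (y + 1)) * (m * (y + 1))) with
    (a * (m * (d + 1)) * (c * (y + 1) * (y + 1)))
    by (rewrite Hc; ring).
  apply div_mul_r, div_add_cancel with (modulus m y * a).
  + destruct H as [q H]; exists q; rewrite <- H; unfold modulus; ring.
  + exists a; reflexivity.
Qed.

(** Sigma01 induction builds the multiple step by step, in place of a definition of the
    factorial. *)
Lemma common_multiple k :
  exists m, 0 < m /\ forall d, d < k -> div (d + 1) m.
Proof.
pattern k.
apply (induction_ex (fun m k => 0 < m /\ forall d, d < k -> div (d + 1) m)).
- def.
- exists 1; split; [rewrite <- (add0l 1); apply lt_succ|].
  intros d Hd; destruct (nlt0 _ Hd).
- intros j [m [Hm H]]; exists (m * (j + 1)); split.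
  + apply mul_pos; [exact Hm|apply ltS, le0].
  + intros d Hd; apply ltS in Hd as [Hd| ->].
    * apply div_mul_r; auto.
    * exists m; ring.
Qed.

(** The clause [m <= v] is what later bounds the quantifier over [m] in [bounds]. *)
Lemma common_multiple_moduli m k :
  0 < m ->
  exists v, 0 < v /\ m <= v /\ forall x, x < k -> div (modulus m x) v.
Proof.
intros Hm; pattern k.
apply (induction_ex (fun v k =>
  0 < v /\ m <= v /\ forall x, x < k -> div (modulus m x) v)).
- def.
- exists m; repeat split; auto using le_refl.
  intros d Hd; destruct (nlt0 _ Hd).
- intros j [v [Hv [Hmv H]]]; exists (v * modulus m j); repeat split.
  + apply mul_pos; auto using modulus_pos.
  + apply le_trans with (1 := Hmv); apply le_iff.
    exists (v * (m * (j + 1))); unfold modulus; ring.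
  + intros d Hd; apply ltS in Hd as [Hd| ->].
    * apply div_mul_r; auto.
    * exists v; ring.
Qed.

Lemma least_number (P : N -> Prop) x :
  Def (fun e => P (e 0%nat)) -> P x ->
  exists y, P y /\ forall z, z < y -> ~ P z.
Proof.
intros HP Hx; apply NNPP; intros C.
enough (H : forall y z, z < y -> ~ P z) by exact (H (x + 1) x (lt_succ x) Hx).
intros y; pattern y; apply induction0; clear y.
- apply Def_all; [def|apply Def_not, HP].
- intros z Hz; destruct (nlt0 _ Hz).
- intros y IH z Hz; apply ltS in Hz as [Hz| ->]; [apply IH, Hz|].
  intros Hy; apply C; exists y; auto.
Qed.

Lemma DefT_pair t u : DefT t -> DefT u -> DefT (fun e => pair (t e) (u e)).
Proof. intros; unfold pair; def. Qed.
Hint Resolve DefT_pair : def.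

Definition bounds (k v : N) : Prop :=
  exists m, m < v + 1 /\ (0 < m /\ (0 < v /\
    ((forall d, d < k -> div (d + 1) m) /\
     (forall x, x < k -> div (modulus m x) v)))).

Lemma Def_bounds t u : DefT t -> DefT u -> Def (fun e => bounds (t e) (u e)).
Proof. intros; unfold bounds; def. Qed.
Hint Resolve Def_bounds : def.

Lemma bounds_exists k : exists v, bounds k v.
Proof.
destruct (common_multiple k) as [m [Hm H]].
destruct (common_multiple_moduli m k Hm) as [v [Hv [Hmv H']]].
exists v, m; rewrite ltS; auto.
Qed.

(** The injection [G] maps [j] to the modulus
    with index [G j]; dividing [v] by these pairwise coprime moduli in turn
    gives a descending sequence of length [n]. *)
Lemma bounds_injection k v n G :
  bounds k v ->
  (forall i, i < n -> exists x, x < k /\ mem M (pair i x) G) ->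
  (forall i j x, mem M (pair i x) G -> mem M (pair j x) G -> i = j) ->
  n < v.
Proof.
intros [m [_ [Hm [Hv [Hd Hx]]]]] HG Hinj.
(* [a] remains of [v] after [i] divisions: it is smaller by at least [i] and keeps the moduli that
   belong to arguments [j >= i]. The bound [a < v + 1] keeps the induction formula bounded. *)
enough (H : forall i, i <= n -> exists a, a < v + 1 /\ (0 < a /\ (a + i <= v /\
  (forall j, j < n -> i <= j -> forall x, x < k -> mem M (pair j x) G ->
     div (modulus m x) a)))).
{ destruct (H n (le_refl n)) as [a [_ [Ha [Hn _]]]].
  apply lt_le_trans with (2 := Hn); rewrite <- (add0l n) at 1.
  apply lt_iff in Ha as [b ->]; apply lt_iff; exists b; ring. }
intros i; num_ind i.
- intros _; exists v; rewrite add0r; auto using lt_succ, le_refl.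
- intros Hi; apply lt_succ_le in Hi.
  destruct (IH (lt_le _ _ Hi)) as [a [_ [Ha [Hav H]]]].
  destruct (HG i Hi) as [y [Hy Hiy]].
  destruct (H i Hi (le_refl i) y Hy Hiy) as [b Hb].
  assert (Hb0 : 0 < b).
  { apply pos_neq0; intros ->; rewrite mul0r in Hb; subst a.
    exact (lt_irrefl _ Ha). }
  (* The modulus is at least 2 and [b] is positive, so this division loses at least one more. *)
  assert (Hba : b + (i + 1) <= v).
  { apply le_trans with (2 := Hav); subst a.
    apply lt_iff in Hm as [c ->], Hb0 as [d ->]; apply le_iff.
    exists (c * y * d + c * y + y * d + y + c * d + c + d);
    unfold modulus; ring. }
  exists b; repeat split; auto.
  + apply ltS, le_trans with (2 := Hba), le_add_l.
  + intros j Hj Hij z Hz Hjz.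
    apply (modulus_coprime m k y); auto.
    * intros <-; rewrite (Hinj _ _ _ Hjz Hiy) in Hij.
      apply lt_succ_le in Hij; exact (lt_irrefl _ Hij).
    * rewrite <- Hb; apply (H j); auto; apply lt_le, lt_succ_le, Hij.
Qed.

(** The graph of h; minimality makes it single-valued. *)
Definition least_bound (k v : N) : Prop :=
  bounds k v /\ forall u, u < v -> ~ bounds k u.

Lemma Def_least_bound t u :
  DefT t -> DefT u -> Def (fun e => least_bound (t e) (u e)).
Proof. intros; unfold least_bound; def. Qed.
Hint Resolve Def_least_bound : def.

Lemma least_bound_exists k : exists v, least_bound k v.
Proof.
destruct (bounds_exists k) as [v Hv].
apply (least_number (bounds k)) in Hv; [exact Hv|def].
Qed.

Lemma least_bound_unique k u v : least_bound k u -> least_bound k v -> u = v.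
Proof.
intros [Hu H] [Hv H']; destruct (lt_trichotomy u v) as [C|[C|C]]; auto;
  exfalso; [exact (H' _ C Hu)|exact (H _ C Hv)].
Qed.

Definition even (x : N) : Prop := exists y, y < x + 1 /\ x = y + y.

Lemma Def_even t : DefT t -> Def (fun e => even (t e)).
Proof. intros; unfold even; def. Qed.
Hint Resolve Def_even : def.

Lemma even_iff x : even x <-> exists y, x = y + y.
Proof.
split; [intros [y [_ H]]; eauto|intros [y ->]; exists y; split; auto].
apply ltS, le_add_l.
Qed.

Lemma even0 : even 0.
Proof. apply even_iff; exists 0; ring. Qed.

Lemma even_succ x : even (x + 1) <-> ~ even x.
Proof.
split.
- rewrite !even_iff; intros [y Hy] [z ->].
  destruct (lt_trichotomy y z) as [C|[->|C]].
  + apply lt_iff in C as [d ->]; apply (add1_neq0 (d + d + 1 + 1)).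
    apply (add_cancel_l _ _ (y + y)); rewrite add0r; rewrite <- Hy at 2; ring.
  + rewrite <- (add0r (z + z)) in Hy at 2; apply add_cancel_l in Hy.
    apply (add1_neq0 0); rewrite Hy; ring.
  + apply lt_iff in C as [d ->]; apply (add1_neq0 (d + d)).
    apply (add_cancel_l _ _ (z + z + 1)); rewrite add0r; rewrite Hy at 2; ring.
- num_ind x.
  + intros H; destruct (H even0).
  + intros H; apply NNPP; intros C; apply H, IH; intros Hx; apply C.
    rewrite even_iff in *; destruct Hx as [y ->]; exists (y + 1); ring.
Qed.

(** * The counterexample *)

(** The color classes of [color], relaxed so that every set between two sets of
    this kind is again of this kind. *)
Definition twisted (A : N -> Prop) (w : N) : Prop :=
  1 < w /\ A w /\
  (forall x, A x -> x <= w + 1 /\ (x = w \/ ~ (even x <-> even w))) /\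
  exists x, A x /\ x <= 1.

(** If [w] and [w'] differed, they would have opposite parities in [B]. The element of [A] that is
    at most 1 differs from both, so its parity would be opposite to both, and there are only two
    parities. *)
Lemma twisted_le A B w w' :
  twisted A w -> (forall x, A x -> B x) -> twisted B w' -> w = w'.
Proof.
intros [Hw [HAw [HA [x [Hx Hx1]]]]] HAB [Hw' [_ [HB _]]].
destruct (HB w (HAB _ HAw)) as [_ [E|E]]; auto.
destruct (HA x Hx) as [_ [E1|E1]].
{ subst; destruct (le_not_lt _ _ Hx1 Hw). }
destruct (HB x (HAB _ Hx)) as [_ [E2|E2]].
{ subst; destruct (le_not_lt _ _ Hx1 Hw'). }
tauto.
Qed.

(** The existence clauses pass up from [A], the universal one passes down from [C]. *)
Lemma twisted_between A B C w :
  twisted A w -> (forall x, A x -> B x) -> (forall x, B x -> C x) ->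
  twisted C w -> twisted B w.
Proof.
intros [Hw [HAw [_ [x [Hx Hx1]]]]] HAB HBC [_ [_ [HC _]]].
repeat split; auto; try (apply HC; auto); eauto.
Qed.

(** The default 3 serves the colorings with [k <= 2], whose classes lie in {0, 1, 2} and need not be
    twisted. *)
Definition value (A : N -> Prop) (v : N) : Prop :=
  (exists w, twisted A w /\ least_bound (w + 1 + 1) v) \/
  ~ (exists w, twisted A w) /\ least_bound (1 + 1 + 1) v.

Lemma value_exists A : exists v, value A v.
Proof.
destruct (classic (exists w, twisted A w)) as [[w Hw]|H].
- destruct (least_bound_exists (w + 1 + 1)) as [v Hv]; exists v; left; eauto.
- destruct (least_bound_exists (1 + 1 + 1)) as [v Hv]; exists v; right; auto.
Qed.

Lemma value_unique A u v : value A u -> value A v -> u = v.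
Proof.
intros [[w [Hw Hu]]|[Hw Hu]] [[w' [Hw' Hv]]|[Hw' Hv]];
  try (exfalso; eauto; fail).
- rewrite <- (twisted_le _ _ _ _ Hw (fun _ H => H) Hw') in Hv.
  eapply least_bound_unique; eassumption.
- eapply least_bound_unique; eassumption.
Qed.

Lemma value_stable (A : N -> N -> Prop) :
  (forall i j x, i <= j -> A i x -> A j x) ->
  exists i, forall j, i <= j -> exists v, value (A i) v /\ value (A j) v.
Proof.
intros HA; destruct (classic (exists i w, twisted (A i) w)) as [[i [w Hw]]|H].
- destruct (classic (exists j, i <= j /\ ~ exists w', twisted (A j) w'))
    as [[j [Hij Hj]]|Hi].
  (* The property is lost at [j]. If it held again at [j'], it would do so with the same [w], and
     then also at [j] in between. *)
  + exists j; intros j' Hj'.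
    destruct (least_bound_exists (1 + 1 + 1)) as [v Hv].
    exists v; split; right; split; auto; intros [w' Hw']; apply Hj; exists w.
    assert (Hi : i <= j') by eauto using le_trans.
    replace w' with w in Hw' by (apply (twisted_le (A i) (A j')); eauto).
    apply twisted_between with (A i) (A j'); eauto.
  + exists i; intros j Hij.
    destruct (least_bound_exists (w + 1 + 1)) as [v Hv].
    exists v; split; left; exists w; split; auto.
    apply NNPP; intros C; apply Hi; exists j; split; auto.
    intros [w' Hw']; apply C; replace w with w'; auto.
    symmetry; apply (twisted_le (A i) (A j)); eauto.
- exists 0; intros j _; destruct (least_bound_exists (1 + 1 + 1)) as [v Hv].
  exists v; split; right; split; eauto; intros [w Hw]; eauto.
Qed.

Lemma value_injection A v n G :
  value A v ->
  ((forall w, ~ twisted A w) -> forall x, A x -> x <= 1 + 1) ->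
  (forall i, i < n -> exists x, A x /\ mem M (pair i x) G) ->
  (forall i j x, mem M (pair i x) G -> mem M (pair j x) G -> i = j) ->
  n < v.
Proof.
intros [[w [Hw [Hv _]]]|[Hw [Hv _]]] HA HG Hinj;
  eapply bounds_injection; eauto; intros i Hi; destruct (HG i Hi) as [x [Hx H]];
  exists x; split; auto; apply ltS.
- destruct Hw as [_ [_ [Hw _]]]; apply Hw, Hx.
- apply HA; eauto.
Qed.

(** * The meaning of the formulas in a model *)

(** A name ending in [_in] denotes the meaning in [M] of the formula with the
    corresponding name. *)
Definition finmem_in (x c : N) : Prop :=
  exists k m n, c = pair k (pair m n) /\ (x < k /\ div (m * (x + 1) + 1) n).

Definition triple_in (c : N) : Prop := exists k m n, c = pair k (pair m n).

Definition fincode_in (c : N) : Prop :=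
  triple_in c /\
  forall c', c' < c -> triple_in c' ->
    ~ (forall x, finmem_in x c' <-> finmem_in x c).

Definition length_in (l h : N) : Prop :=
  forall i, i < h <-> exists j, finmem_in (pair i j) l.

Definition Seq_in (l : N) : Prop :=
  fincode_in l /\
  ((forall z, finmem_in z l -> exists i j, z = pair i j) /\
   ((forall i j k, finmem_in (pair i j) l -> finmem_in (pair i k) l -> j = k) /\
    (exists h, length_in l h))).

Definition inA_in (x l : N) : Prop :=
  exists h i, length_in l h /\ (i < h /\ finmem_in (pair i x) l).

Definition function_in (D R : N -> Prop) (F : set M) : Prop :=
  (forall z, mem M z F -> exists i j, z = pair i j /\ (D i /\ R j)) /\
  ((forall i j k, mem M (pair i j) F -> mem M (pair i k) F -> j = k) /\
   (forall i, D i -> exists j, mem M (pair i j) F)).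

Definition bijection_in (D R : N -> Prop) (G : set M) : Prop :=
  function_in D R G /\
  ((forall i i' j, mem M (pair i j) G -> mem M (pair i' j) G -> i = i') /\
   (forall j, R j -> exists i, mem M (pair i j) G)).

Definition card_gt_in (A : N -> Prop) (m : N) : Prop :=
  exists n, m < n /\ exists G, bijection_in (fun j => j < n) A G.

Definition same_value_in (F : set M) (l l' : N) : Prop :=
  exists y, mem M (pair l y) F /\ mem M (pair l' y) F.

Definition extensional_in (F : set M) : Prop :=
  forall l l', Seq_in l -> Seq_in l' ->
    (forall x, inA_in x l <-> inA_in x l') ->
    same_value_in F l l'.

Definition all_in (_ : N) : Prop := ~ False.

Definition nested_in (L : set M) : Prop :=
  function_in all_in all_in L /\
  ((forall m l, mem M (pair m l) L -> Seq_in l) /\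
   ((forall m l l', mem M (pair m l) L -> mem M (pair (m + 1) l') L ->
       forall x, inA_in x l -> inA_in x l') /\
    (exists U, forall x, mem M x U <->
       exists m l, mem M (pair m l) L /\ inA_in x l))).

Definition AS_in (F : set M) : Prop :=
  function_in all_in all_in F /\
  (extensional_in F /\
   (forall L, nested_in L ->
      exists i, forall j, i <= j ->
        exists l l', mem M (pair i l) L /\
          (mem M (pair j l') L /\ same_value_in F l l'))).

Definition FIPP1_in : Prop :=
  forall n F, AS_in F ->
    exists k, forall f, function_in (fun i => i <= k) (fun i => i <= n) f ->
      exists l c, Seq_in l /\ (c <= n /\
        ((forall x, inA_in x l <-> (x <= k /\ mem M (pair x c) f)) /\
         (exists y, mem M (pair l y) F /\ card_gt_in (fun x => inA_in x l) y))).

Lemma sat_iff_Imp e s p q (P Q : Prop) :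
  (sat M e s p <-> P) -> (sat M e s q <-> Q) ->
  (sat M e s (Imp p q) <-> (P -> Q)).
Proof. simpl; tauto. Qed.

Lemma sat_iff_Neg e s p (P : Prop) :
  (sat M e s p <-> P) -> (sat M e s (Neg p) <-> ~ P).
Proof. simpl; tauto. Qed.

Lemma sat_iff_And e s p q (P Q : Prop) :
  (sat M e s p <-> P) -> (sat M e s q <-> Q) ->
  (sat M e s (And p q) <-> (P /\ Q)).
Proof. rewrite sat_And; tauto. Qed.

Lemma sat_iff_Or e s p q (P Q : Prop) :
  (sat M e s p <-> P) -> (sat M e s q <-> Q) ->
  (sat M e s (Or p q) <-> (P \/ Q)).
Proof. rewrite sat_Or; tauto. Qed.

Lemma sat_iff_Iff e s p q (P Q : Prop) :
  (sat M e s p <-> P) -> (sat M e s q <-> Q) ->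
  (sat M e s (Iff p q) <-> (P <-> Q)).
Proof. rewrite sat_Iff; tauto. Qed.

Lemma sat_iff_All1 e s p (P : N -> Prop) :
  (forall x, sat M (scons x e) s p <-> P x) ->
  (sat M e s (All1 p) <-> forall x, P x).
Proof. simpl; firstorder. Qed.

Lemma sat_iff_Ex1 e s p (P : N -> Prop) :
  (forall x, sat M (scons x e) s p <-> P x) ->
  (sat M e s (Ex1 p) <-> exists x, P x).
Proof. rewrite sat_Ex1; firstorder. Qed.

Lemma sat_iff_All2 e s p (P : set M -> Prop) :
  (forall X, sat M e (scons X s) p <-> P X) ->
  (sat M e s (All2 p) <-> forall X, P X).
Proof. simpl; firstorder. Qed.

Lemma sat_iff_Ex2 e s p (P : set M -> Prop) :
  (forall X, sat M e (scons X s) p <-> P X) ->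
  (sat M e s (Ex2 p) <-> exists X, P X).
Proof. rewrite sat_Ex2; firstorder. Qed.

Lemma sat_FIPP1 e s : sat M e s FIPP1 <-> FIPP1_in.
Proof.
(* The abbreviations stay folded, so that an existential formula is matched with [exists] and not
   read as a negated universal one. *)
cbv - [iff sat Neg And Or Iff Ex1 Ex2 FIPP1_in].
repeat lazymatch goal with
  | |- sat _ _ _ (Neg _) <-> _ => apply sat_iff_Neg
  | |- sat _ _ _ (And _ _) <-> _ => apply sat_iff_And
  | |- sat _ _ _ (Or _ _) <-> _ => apply sat_iff_Or
  | |- sat _ _ _ (Iff _ _) <-> _ => apply sat_iff_Iff
  | |- sat _ _ _ (Ex1 _) <-> _ => apply sat_iff_Ex1; intros ?
  | |- sat _ _ _ (Ex2 _) <-> _ => apply sat_iff_Ex2; intros ?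
  | |- sat _ _ _ (Imp _ _) <-> _ => apply sat_iff_Imp
  | |- sat _ _ _ (All1 _) <-> _ => apply sat_iff_All1; intros ?
  | |- sat _ _ _ (All2 _) <-> _ => apply sat_iff_All2; intros ?
  | |- sat _ _ _ _ <-> _ => reflexivity
  end.
Qed.

Lemma finmem_lt z c : finmem_in z c -> z < c.
Proof.
intros [k [m [n [-> [H _]]]]]; apply lt_le_trans with (1 := H), pair_ge_l.
Qed.

Lemma finmem_bounded z c :
  finmem_in z c <->
  exists k, k < c + 1 /\ exists m, m < c + 1 /\ exists n, n < c + 1 /\
    (c = pair k (pair m n) /\ (z < k /\ div (modulus m z) n)).
Proof.
split.
- intros [k [m [n [E H]]]]; exists k; rewrite ltS; split.
  { subst c; apply pair_ge_l. }
  exists m; rewrite ltS; split.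
  { subst c; eapply le_trans; [apply pair_ge_l|apply pair_ge_r]. }
  exists n; rewrite ltS; split; [|split; [exact E|exact H]].
  subst c; eapply le_trans; [apply pair_ge_r|apply pair_ge_r].
- intros [k [_ [m [_ [n [_ H]]]]]]; exists k, m, n; exact H.
Qed.

(** A bounded substitute for [inA_in], which quantifies over lengths without bound; a position is
    always less than the code. *)
Definition range (l x : N) : Prop := exists i, i < l /\ finmem_in (pair i x) l.

Lemma range_iff l x : range l x <-> exists i, finmem_in (pair i x) l.
Proof.
split; [intros [i [_ H]]; eauto|intros [i H]; exists i; split; auto].
eapply le_lt_trans; [apply pair_ge_l|apply finmem_lt, H].
Qed.

Lemma range_lt l x : range l x -> x < l.
Proof.
intros [i [_ H]]; eapply le_lt_trans; [apply pair_ge_r|apply finmem_lt, H].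
Qed.

Lemma inA_range l x : Seq_in l -> inA_in x l <-> range l x.
Proof.
intros [_ [_ [_ [h Hh]]]]; rewrite range_iff; split.
- intros [h' [i [_ [_ H]]]]; eauto.
- intros [i H]; exists h, i; repeat split; auto; try apply Hh; eauto.
Qed.

Lemma Def_finmem t u : DefT t -> DefT u -> Def (fun e => finmem_in (t e) (u e)).
Proof.
intros Ht Hu; eapply Def_ext; [intros e; symmetry; apply finmem_bounded|].
def.
Qed.
Hint Resolve Def_finmem : def.

Lemma Def_range t u : DefT t -> DefT u -> Def (fun e => range (t e) (u e)).
Proof. intros; unfold range; def. Qed.
Hint Resolve Def_range : def.

Lemma Def_twisted t u :
  DefT t -> DefT u -> Def (fun e => twisted (range (t e)) (u e)).
Proof.
intros Ht Hu.
apply Def_ext with (fun e => 1 < u e /\ (range (t e) (u e) /\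
  ((forall x, x < t e -> range (t e) x ->
     x <= u e + 1 /\ (x = u e \/ ~ (even x <-> even (u e)))) /\
   exists x, x < t e /\ (range (t e) x /\ x <= 1)))).
- intros e; unfold twisted; split; intros [H1 [H2 [H3 [x H4]]]];
    repeat split; auto; try (apply H3; auto using range_lt);
    exists x; intuition auto using range_lt.
- def.
Qed.
Hint Resolve Def_twisted : def.

Lemma Def_value t u :
  DefT t -> DefT u -> Def (fun e => value (range (t e)) (u e)).
Proof.
intros Ht Hu.
apply Def_ext with (fun e =>
  (exists w, w < t e /\ (twisted (range (t e)) w /\
     least_bound (w + 1 + 1) (u e))) \/
  ~ (exists w, w < t e /\ twisted (range (t e)) w) /\
    least_bound (1 + 1 + 1) (u e)).
- intros e; unfold value.
  assert (H : forall w, twisted (range (t e)) w -> w < t e)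
    by (intros w [_ [Hw _]]; apply range_lt, Hw).
  assert (E : (exists w, w < t e /\ twisted (range (t e)) w) <->
              exists w, twisted (range (t e)) w)
    by (split; intros [w Hw]; exists w; intuition auto).
  rewrite E; split; (intros [[w Hw]|Hw]; [left; exists w|right; exact Hw]);
    intuition auto.
- def.
Qed.
Hint Resolve Def_value : def.

Lemma graph_exists (P : N -> N -> Prop) :
  Def (fun e => P (e 0%nat) (e 1%nat)) ->
  exists F, (forall z, mem M z F -> exists i j, z = pair i j) /\
    forall i j, mem M (pair i j) F <-> P i j.
Proof.
intros HP.
destruct (comprehension0 (fun z => exists j, j < z + 1 /\
  exists i, i < z + 1 /\ (z = pair i j /\ P i j))) as [F HF].
- def.
- exists F; split.
  + intros z Hz; apply HF in Hz as [j [_ [i [_ [Hz _]]]]]; eauto.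
  + intros i j; rewrite HF; split.
    * intros [j' [_ [i' [_ [E H]]]]]; apply pair_inj in E as [-> ->]; exact H.
    * intros H; exists j; rewrite ltS; split; [apply pair_ge_r|].
      exists i; rewrite ltS; split; [apply pair_ge_l|auto].
Qed.

Lemma value_graph : exists F, AS_in F /\
  forall l v, mem M (pair l v) F <-> value (range l) v.
Proof.
destruct (graph_exists (fun l v => value (range l) v)) as [F [HF HFv]];
  [def|].
exists F; split; [|exact HFv]; split; [|split].
- split; [|split].
  + intros z Hz; destruct (HF z Hz) as [i [j ->]]; exists i, j.
    unfold all_in; tauto.
  + intros i j k; rewrite !HFv; apply value_unique.
  + intros i _; destruct (value_exists (range i)) as [v Hv].
    exists v; apply HFv, Hv.
- intros l l' Hl Hl' H; destruct (value_exists (range l)) as [v Hv].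
  exists v; rewrite !HFv; split; auto.
  replace (range l') with (range l); auto.
  extensionality x; apply propositional_extensionality.
  rewrite <- !inA_range; auto.
- intros L [[_ [HLf HLt]] [HLS [HLm _]]].
  pose (A := fun m x => exists l, mem M (pair m l) L /\ range l x).
  assert (HA : forall m l, mem M (pair m l) L -> A m = range l).
  { intros m l Hl; extensionality x; apply propositional_extensionality.
    split; [intros [l' [Hl' Hx]]|intros Hx; exists l; auto].
    rewrite (HLf _ _ _ Hl Hl'); exact Hx. }
  destruct (value_stable A) as [i Hi].
  (* Nestedness concerns consecutive terms only. That [x] persists from [i] to [i + d] follows by
     Sigma01 induction on [d], the code of the term being the unbounded witness. *)
  + intros i j x Hij Hx; apply le_iff in Hij as [d ->].
    pattern d.
    apply (induction_ex (fun l d => mem M (pair (i + d) l) L /\ range l x));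
      [def|..].
    * rewrite add0r; exact Hx.
    * intros d' [l [Hl Hlx]].
      destruct (HLt (i + d' + 1)) as [l' Hl']; [unfold all_in; tauto|].
      exists l'; rewrite add_assoc; split; auto.
      apply inA_range; [eapply HLS, Hl'|].
      apply (HLm _ _ _ Hl Hl'), inA_range; [eapply HLS, Hl|exact Hlx].
  + exists i; intros j Hj; destruct (Hi j Hj) as [v [Hv Hv']].
    destruct (HLt i) as [l Hl]; [unfold all_in; tauto|].
    destruct (HLt j) as [l' Hl']; [unfold all_in; tauto|].
    rewrite (HA _ _ Hl) in Hv; rewrite (HA _ _ Hl') in Hv'.
    exists l, l'; repeat split; auto; exists v; rewrite !HFv; auto.
Qed.

(** * The coloring *)

(** Color 0 means even when [x + 1 < k], and odd when [x] is [k - 1] or [k]; the comparisons with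
    [x + 1] avoid subtraction and also cover [k = 0]. *)
Definition color (k x c : N) : Prop :=
  x <= k /\ (c <= 1 /\
    ((x + 1 < k -> (even x <-> c = 0)) /\ (k <= x + 1 -> (even x <-> c <> 0)))).

Lemma le1_iff c : c <= 1 <-> c = 0 \/ c = 1.
Proof.
rewrite <- (add0l 1), <- ltS, add0l; split.
- intros H; apply ltS in H as [H|H]; auto.
  left; rewrite <- (add0l 1) in H; apply ltS in H as [H|H]; auto.
  destruct (nlt0 _ H).
- intros [->| ->]; [apply ltS, le0|apply lt_succ].
Qed.

Lemma one_neq0 : 1 <> 0.
Proof. rewrite <- (add0l 1); apply add1_neq0. Qed.

Lemma color_function k :
  exists f, function_in (fun i => i <= k) (fun i => i <= 1) f /\
    forall x c, mem M (pair x c) f <-> color k x c.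
Proof.
destruct (graph_exists (color k)) as [f [Hf Hfc]]; [unfold color; def|].
exists f; split; [|exact Hfc]; split; [|split].
- intros z Hz; destruct (Hf z Hz) as [i [j ->]]; exists i, j.
  apply Hfc in Hz; unfold color in Hz; tauto.
- intros i j l; rewrite !Hfc; intros [_ [Hj [H1 H2]]] [_ [Hl [H3 H4]]].
  apply le1_iff in Hj, Hl.
  generalize one_neq0 (eq_refl 0) (le_or_lt k (i + 1)); intros H01 H00 H.
  destruct Hj as [->| ->], Hl as [->| ->]; auto; exfalso; tauto.
- intros i Hi.
  enough (exists c, color k i c) as [c Hc] by (exists c; apply Hfc, Hc).
  generalize one_neq0; intros H1.
  destruct (classic ((even i <-> i + 1 < k))) as [H|H]; [exists 0|exists 1];
    (split; [exact Hi|split; [apply le1_iff; auto|]]);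
    generalize (le_not_lt k (i + 1)) (eq_refl 0); intros; tauto.
Qed.

Lemma color_twisted k c :
  c <= 1 -> 1 + 1 < k -> exists w, twisted (fun x => color k x c) w.
Proof.
intros Hc Hk; destruct (zero_or_succ k) as [->|[j ->]];
  [destruct (nlt0 _ Hk)|].
apply add_lt_cancel_r in Hk.
(* The last two numbers [j] and [j + 1] have opposite parities, so one of them has the reversed
   parity that color [c] demands there. *)
assert (exists w, (w = j \/ w = j + 1) /\ (even w <-> c <> 0))
  as [w [Hw Hwc]].
{ generalize (even_succ j); intros Hj.
  destruct (classic (even j <-> c <> 0)); [exists j|exists (j + 1)]; tauto. }
assert (Hjw : j <= w)
  by (destruct Hw as [->| ->]; auto using le_refl, le_add_l).
assert (Hwj : w <= j + 1)
  by (destruct Hw as [->| ->]; auto using le_refl, le_add_l).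
assert (Hjw' : j + 1 <= w + 1) by (apply add_le; auto using le_refl).
exists w; split; [|split; [|split]].
- apply lt_le_trans with (1 := Hk), Hjw.
- split; [exact Hwj|split; [exact Hc|split; [|tauto]]].
  intros H; destruct (le_not_lt _ _ Hjw' H).
- intros x [Hx [_ [Hx1 Hx2]]]; split; [exact (le_trans _ _ _ Hx Hjw')|].
  destruct (le_or_lt (j + 1) (x + 1)) as [C|C]; [|specialize (Hx1 C); tauto].
  specialize (Hx2 C); generalize (even_succ j); intros Hj.
  assert (Hxj : x = j \/ x = j + 1).
  { destruct Hx as [Hx|Hx]; auto; apply ltS in Hx; left.
    apply le_antisym; auto; apply ltS; apply lt_succ_le, C. }
  destruct Hw as [->| ->], Hxj as [->| ->]; tauto.
(* The small element is [c] itself: 0 has color 0 and 1 has color 1, because [k >= 3] keeps both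
   away from the exchanged end. *)
- exists c; split; [|exact Hc].
  assert (H : c + 1 < j + 1)
    by (apply ltS, lt_succ_le; apply le_lt_trans with (1 := Hc), Hk).
  split; [apply lt_le, lt_trans with (1 := lt_succ c), H|split; [exact Hc|]].
  split; [|intros C; destruct (le_not_lt _ _ C H)]; intros _.
  generalize even0 (even_succ 0) one_neq0 (eq_refl 0); rewrite add0l; intros.
  apply le1_iff in Hc as [->| ->]; tauto.
Qed.

Lemma FIPP1_fails : ~ FIPP1_in.
Proof.
intros H; destruct value_graph as [F [HF HFv]].
(* Taking n = 1 gives two colors, 0 and 1. *)
destruct (H 1 F HF) as [k Hk]; clear H.
destruct (color_function k) as [f [Hf Hfc]].
destruct (Hk f Hf) as
  [l [c [Hl [Hc [HA [v [Hv [n [Hn [G [[HG1 [_ HG2]] [HG3 _]]]]]]]]]]]].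
apply HFv in Hv; apply (lt_irrefl v), (lt_trans _ _ _ Hn).
assert (HA' : range l = fun x => color k x c).
{ extensionality x; apply propositional_extensionality.
  rewrite <- inA_range, HA, Hfc by exact Hl; unfold color; tauto. }
apply (value_injection _ _ _ G Hv); [|intros i Hi|exact HG3].
- rewrite HA'; intros Hw x [Hx _]; apply le_trans with (1 := Hx).
  destruct (le_or_lt k (1 + 1)) as [C|C]; auto.
  destruct (color_twisted k c Hc C) as [w Hw']; destruct (Hw w Hw').
- destruct (HG2 i Hi) as [x Hx]; exists x; split; auto.
  destruct (HG1 _ Hx) as [i' [x' [E [_ H]]]].
  apply pair_inj in E as [_ ->]; exact (proj1 (inA_range _ _ Hl) H).
Qed.

End Semantics.

Theorem theorem4p1 : proves RCA0 (Neg FIPP1).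
Proof.
apply (completeness RCA0 RCA0_subst); [reflexivity|].
intros M e s HM; apply sat_Neg; rewrite (sat_FIPP1 M HM).
exact (FIPP1_fails M (s 0) HM).
Qed.
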